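(* Let $\Sigma$ be a compact bordered surface with boundary components $1,\dots,n$, equipped with an ideal triangulation $T$ with ideal edge set $E$ and ideal face set $F$, and let $l^0\in\mathbb{R}_+^{|E|}$ be a fixed discrete hyperbolic metric. Let $W\subset\mathbb{R}^n$ be the space of admissible discrete conformal factors and let $\psi:W\to\mathbb{R}_+^n$, $\psi(w)=(B_1,\dots,B_n)$, be the boundary-length map. Then $\psi$ is a diffeomorphism from $W$ onto $\mathbb{R}_+^n$.
   Context: Setting: $T^*$ is a triangulation of a closed surface $S$ with vertex set $T^0$, edge set $T^1$, face set $T^2$; $N(T^0)$ is a small open regular disjoint neighborhood of $T^0$; $\Sigma=S\setminus N(T^0)$ is compact with $|T^0|=n$ boundary components, labeled $1,\dots,n$. $T=T^*\cap\Sigma$ is the ideal triangulation; ideal edges $E=T^1\cap\Sigma$, ideal faces $F=T^2\cap\Sigma$. The ideal edge between boundary components $i,j$ is denoted $ij$; the ideal face adjacent to boundary components $i,j,k$ is denoted $ijk$. The intersection of an ideal face with $\partial\Sigma$ consists of B-arcs. A discrete hyperbolic metric is $l\in\mathbb{R}_+^{|E|}$, $ij\mapsto l_{ij}>0$. For each ideal face $ijk$ there is a right-angled hyperbolic hexagon, unique up to isometry, whose three pairwise non-adjacent sides have lengths $l_{ij},l_{jk},l_{ki}$; gluing these hexagons gives a hyperbolic surface $\Sigma_l$ with geodesic boundary. In the hexagon of face $f=ijk$, $\theta_i^f$ denotes the length of the side opposite to the side of length $l_{jk}$ (the B-arc on boundary component $i$); it satisfies $\cosh\theta_i^f=\frac{\cosh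 l_{jk}+\cosh l_{ki}\cosh l_{ij}}{\sinh l_{ki}\sinh l_{ij}}$. A vector $w\in\mathbb{R}^n$ is an admissible discrete conformal factor if $w_i+w_j>-\ln\cosh\frac{l^0_{ij}}{2}$ for every ideal edge $ij\in E$; $W$ is the (convex, open) set of these. For $w\in W$ the metric $l=w*l^0$ is defined by $\cosh\frac{l_{ij}}{2}=e^{w_i+w_j}\cosh\frac{l^0_{ij}}{2}$. For $w\in W$, $B_i=\sum_{f\in F_i}\theta_i^f$ is the length of boundary component $i$ of $\Sigma_{w*l^0}$, where $F_i$ is the set of ideal faces adjacent to boundary component $i$. *)

(* Defs.v *)
From Stdlib Require Import Reals.
From Coquelicot Require Import Coquelicot.
From mathcomp Require Import ssreflect ssrfun ssrbool eqtype ssrnat seq choice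
  fintype fingraph bigop.

Set Implicit Arguments.
Unset Strict Implicit.
Unset Printing Implicit Defensive.

(* A (generalized) triangulation is given by a finite set of triangles *)
(* [face]; a side of a triangle is a pair (f, c) : face * 'I_3, namely *)
(* the side opposite to corner c of f; a corner is also a pair (f, c). *)
(* Sides are glued in pairs by the fixed-point-free involution [pair]; *)
(* [twist s] records which of the two possible identifications of the  *)
(* endpoints is used.  Gluing triangles pairwise along all sides always *)
(* yields a closed surface; its vertices are the classes of corners    *)
(* under the identification, and [vlabel] labels them bijectively by   *)
(* 1..n (here 'I_n).                                                   *)

Record tri_data (n : nat) := TriData {
  face : finType;
  pair : face * 'I_3 -> face * 'I_3;
  twist : face * 'I_3 -> bool;
  vlabel : face * 'I_3 -> 'I_n
}.

Section Tri.
Variables (n : nat) (T : tri_data n).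

Definition side := (face T * 'I_3)%type.

(* the two endpoint corners of the side opposite corner c of f *)
Definition endA (s : side) : side := (s.1, ordS s.2).
Definition endB (s : side) : side := (s.1, ordS (ordS s.2)).

Definition glued (p q : side) : bool :=
  [exists s : side,
     ((p == endA s) &&
        (q == if twist s then endB (pair s) else endA (pair s)))
  || ((p == endB s) &&
        (q == if twist s then endA (pair s) else endB (pair s)))].

Definition face_adj (f g : face T) : bool :=
  [exists c : 'I_3, (pair (f, c)).1 == g].

Definition valid_triangulation : Prop :=
  [/\ (0 < #|face T|)%N,
      (forall s : side, pair (pair s) = s /\ pair s <> s),
      (forall s : side, twist (pair s) = twist s),
      (forall f g : face T, connect face_adj f g)
    & (forall p q : side, vlabel p = vlabel q <-> connect glued p q)
      /\ (forall i : 'I_n, exists p : side, vlabel p = i)].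

(* a discrete hyperbolic metric: a positive length per ideal edge,
   i.e. per pair of glued sides *)
Definition hyp_metric (l : side -> R) : Prop :=
  forall s, (0 < l s)%R /\ l (pair s) = l s.

End Tri.

Open Scope R_scope.

Definition vec (n : nat) := 'I_n -> R.

Definition acosh (x : R) : R := ln (x + sqrt (x * x - 1)).

Section Conformal.
Variables (n : nat) (T : tri_data n) (l0 : side T -> R).

Definition admissible (w : vec n) : Prop :=
  forall s : side T,
    w (vlabel (endA s)) + w (vlabel (endB s)) > - ln (cosh (l0 s / 2)).

Definition conf_len (w : vec n) (s : side T) : R :=
  2 * acosh (exp (w (vlabel (endA s)) + w (vlabel (endB s)))
             * cosh (l0 s / 2)).

(* B-arc length theta_i^f at corner p = (f, c) of the right-angled
   hexagon of face f for the metric l *)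
Definition theta (l : side T -> R) (p : side T) : R :=
  let a := l p in
  let b := l (endA p) in
  let c := l (endB p) in
  acosh ((cosh a + cosh b * cosh c) / (sinh b * sinh c)).

Definition psi (w : vec n) : vec n :=
  fun i => \big[Rplus/0]_(p : side T | vlabel p == i) theta (conf_len w) p.

End Conformal.

Section Smooth.
Variable n : nat.

Definition upd (x : vec n) (j : 'I_n) (t : R) : vec n :=
  fun i => if i == j then t else x i.

Definition pderiv (g : vec n -> R) (j : 'I_n) (x : vec n) : R :=
  Derive (fun t => g (upd x j t)) (x j).

Definition cont_at (g : vec n -> R) (x : vec n) : Prop :=
  forall eps, 0 < eps -> exists delta, 0 < delta /\
    forall y : vec n, (forall i, Rabs (y i - x i) < delta) ->
      Rabs (g y - g x) < eps.

Fixpoint Ck (k : nat) (U : vec n -> Prop) (g : vec n -> R) : Prop :=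
  (forall x, U x -> cont_at g x) /\
  match k with
  | O => True
  | S k' => (forall j x, U x -> ex_derive (fun t => g (upd x j t)) (x j))
            /\ (forall j, Ck k' U (pderiv g j))
  end.

Definition smooth_map (U : vec n -> Prop) (f : vec n -> vec n) : Prop :=
  forall (i : 'I_n) (k : nat), Ck k U (fun x => f x i).

Definition open_set (U : vec n -> Prop) : Prop :=
  forall x, U x -> exists r, 0 < r /\
    forall y : vec n, (forall i, Rabs (y i - x i) < r) -> U y.

Definition diffeo_onto (U V : vec n -> Prop) (f : vec n -> vec n) : Prop :=
  [/\ open_set U, open_set V,
      (forall x, U x -> V (f x)),
      smooth_map U f
    & exists g : vec n -> vec n,
        [/\ (forall y, V y -> U (g y)),
            (forall x, U x -> forall i, g (f x) i = x i),
            (forall y, V y -> forall i, f (g y) i = y i)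
          & smooth_map V g]].

End Smooth.

(* Main.v *)
(** On W the boundary-length map has a negative definite Jacobian: in one
    hexagon, with C_i = cosh l_i, where l_i is the edge opposite to corner i,
    dC_i = 2 (C_i + 1) (dw_j + dw_k), and the form sum_i dw_i dtheta_i of the arcs theta_i is a
    negative multiple of sum_i 2 (C_i - 1) dw_i^2 plus, for each pair i, j with third corner k,
    (dw_i - dw_j)^2 + (C_i + C_j) / (C_k - 1) (dw_i + dw_j)^2.  As W is convex,
    the map is injective.  It is also proper onto the positive orthant: bounded arc
    lengths keep C_i away from 1 and bound w from below, while a large w_i makes
    every arc on the component i short.  Hence, given a target B, the function
    sum_i (B_i(w) / B_i + B_i / B_i(w)) attains its minimum on W; differentiating it
    there in the direction of the vector 1 / B_i - B_i / B_i(w)^2 and using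
    definiteness shows that this vector vanishes, so B is attained. *)

(* Properness serves twice: it yields the minimum behind surjectivity, and it makes the inverse
   continuous. Smoothness of the inverse remains, with [Ck] defined by iterated partial derivatives.
   The tool is the Caratheodory slope: an increment of the map is a matrix of slopes, continuous at
   the base point, times the increment of the argument. Along the inverse this becomes a linear
   system that the adjugate solves, so the partial derivatives of the inverse are cofactors over a
   determinant. These are built from polynomials in the entries of the Jacobian at the inverse
   point, which drives the induction on k. The hexagons are treated through hyperbolic cosines of
   edges, which are polynomial in the exponentials of the factors. Since sinh^2 of an arc is a
   rational function of these cosines, properness reduces to polynomial inequalities. The corners of
   one triangle may lie on the same boundary component, so these inequalities treat the three
   exponentials as independent positive numbers. *)
Require Import Defs.
From Stdlib Require Import Reals.
From Coquelicot Require Import Coquelicot.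
From mathcomp Require Import ssreflect ssrfun ssrbool eqtype ssrnat seq choice
  fintype fingraph bigop.
From Stdlib Require Import Lra Classical ClassicalEpsilon FunctionalExtensionality.
From HB Require Import structures.
From mathcomp Require ssralg perm matrix Rstruct.

(** * Cramer's rule over the reals *)

HB.instance Definition _ := Monoid.isComLaw.Build R 0%R Rplus
  (fun x y z => esym (Rplus_assoc x y z)) Rplus_comm Rplus_0_l.

Module Cramer.
Import ssralg perm matrix Rstruct GRing.Theory.
Local Open Scope ring_scope.

Section Cramer.
Variable n : nat.
Implicit Type M : 'I_n -> 'I_n -> R.

Definition det M : R := \det (\matrix_(i, j) M i j).
Definition adj M (i j : 'I_n) : R := (\adj (\matrix_(i, j) M i j)) i j.

(** Cramer's rule without division, from adj(A) A = det(A) 1: it can be applied to a slope matrix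
    before its determinant is known to be nonzero. *)
Lemma adj_mul M (h : 'I_n -> R) i :
  \big[Rplus/R0]_k Rmult (adj M i k) (\big[Rplus/R0]_j Rmult (M k j) (h j)) =
  Rmult (det M) (h i).
Proof.
pose A := \matrix_(i, j) M i j; pose v := \col_j h j.
have : (\adj A *m (A *m v)) i ord0 = (\det A)%:M i i * v i ord0.
  by rewrite mulmxA mul_adj_mx mul_scalar_mx !mxE eqxx mulr1n.
rewrite !mxE eqxx mulr1n => E; apply: etrans E.
apply: eq_bigr => k _; congr Rmult; rewrite !mxE.
by apply: eq_bigr => j _; rewrite !mxE.
Qed.

Lemma det_neq0 M :
  (forall v : 'I_n -> R,
     (forall i, \big[Rplus/R0]_j Rmult (M i j) (v j) = R0) ->
     forall i, v i = R0) ->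
  det M <> R0.
Proof.
(* [det0P] produces a row vector in the left kernel; passing to the transpose turns it into a vector
   of the right kernel. *)
move=> inj; rewrite /det -det_tr => /eqP/det0P [v v0 vM].
case/eqP: v0; apply/rowP => i; rewrite mxE; apply: (inj (v ord0)) => k.
have := congr1 (fun B : 'rV_n => B ord0 k) vM; rewrite !mxE => E; apply: etrans E.
by apply: eq_bigr => j _; rewrite !mxE; apply: Rmult_comm.
Qed.

End Cramer.
Arguments det {n}.
Arguments adj {n}.

Section Closure.
Variables (X : Type) (P : (X -> R) -> Prop).
Hypothesis Pconst : forall c : R, P (fun _ => c).
Hypothesis Padd : forall f g : X -> R,
  P f -> P g -> P (fun x => Rplus (f x) (g x)).
Hypothesis Pmul : forall f g : X -> R,
  P f -> P g -> P (fun x => Rmult (f x) (g x)).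

Lemma big_closed (op : R -> R -> R) idx I (r : seq I) (F : I -> X -> R) :
  (forall f g, P f -> P g -> P (fun x => op (f x) (g x))) ->
  (forall i, P (F i)) -> P (fun x => \big[op/idx]_(i <- r) F i x).
Proof.
move=> Pop PF; elim: r => [|i r IH].
  rewrite (_ : (fun x => _) = (fun _ => idx)) //.
  by apply: functional_extensionality => x; rewrite big_nil.
rewrite (_ : (fun x => _) =
             (fun x => op (F i x) (\big[op/idx]_(i <- r) F i x))).
  exact: Pop.
by apply: functional_extensionality => x; rewrite big_cons.
Qed.

(** A determinant is a polynomial in the entries, so it stays in any class of functions that
    contains the constants and is closed under sums and products. The class [P] is later continuity
    at a point, and then C^k on an open set. *)
Lemma determinant_closed m (A : X -> 'M[R]_m) :
  (forall i j, P (fun x => A x i j)) -> P (fun x => \det (A x)).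
Proof.
move=> PA; apply: big_closed => // s.
apply: (Pmul (fun=> (-1) ^+ s)); first exact: Pconst.
exact: big_closed.
Qed.

Lemma det_closed n (a : X -> 'I_n -> 'I_n -> R) :
  (forall i j, P (fun x => a x i j)) -> P (fun x => det (a x)).
Proof.
move=> Pa; apply: determinant_closed => i j.
rewrite (_ : (fun x => _) = (fun x => a x i j)) //.
by apply: functional_extensionality => x; rewrite mxE.
Qed.

Lemma adj_closed n (a : X -> 'I_n -> 'I_n -> R) i j :
  (forall i j, P (fun x => a x i j)) -> P (fun x => adj (a x) i j).
Proof.
move=> Pa.
rewrite (_ : (fun x => _) = fun x => Rmult ((-1) ^+ (j + i))
   (\det (row' j (col' i (\matrix_(k, l) a x k l))))).
  apply: (Pmul (fun=> (-1) ^+ (j + i))); first exact: Pconst.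
  apply: determinant_closed => k l.
  rewrite (_ : (fun x => _) = (fun x => a x (lift j k) (lift i l))) //.
  by apply: functional_extensionality => x; rewrite !mxE.
by apply: functional_extensionality => x; rewrite /adj mxE.
Qed.

End Closure.
End Cramer.

(** * Functions of class C^k on open sets of R^n *)

(** Serves to choose one radius or one bound for all indices at once, in place of explicit minima
    and maxima over a finite type. *)
Lemma filter_forall_fin (I : finType) (T : Type) (G : (T -> Prop) -> Prop)
    {FG : Filter G} (P : I -> T -> Prop) :
  (forall i, G (P i)) -> G (fun a => forall i, P i a).
Proof.
move=> GP.
have H (s : seq I) : G (fun a => forall i, i \in s -> P i a).
  elim: s => [|i s IH]; first exact: filter_forall.
  apply: filter_imp (filter_and _ _ (GP i) IH) => a [Pi Ps] j.
  by rewrite inE => /orP [/eqP -> //|]; apply: Ps.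
apply: filter_imp (H (enum I)) => a Pa i.
by apply: Pa; rewrite mem_enum.
Qed.

Lemma Rsum_scal (I : Type) (r : seq I) (P : pred I) (F : I -> R) c :
  c * \big[Rplus/0]_(i <- r | P i) F i = \big[Rplus/0]_(i <- r | P i) (c * F i).
Proof.
by apply: (big_morph (Rmult c)) => [x y|]; rewrite ?Rmult_plus_distr_l ?Rmult_0_r.
Qed.

Lemma Rsum_ge0 (I : Type) (r : seq I) (P : pred I) (F : I -> R) :
  (forall i, P i -> 0 <= F i) -> 0 <= \big[Rplus/0]_(i <- r | P i) F i.
Proof.
by move=> F0; apply: (big_ind (Rle 0)) => [|x y x0 y0|//]; lra.
Qed.

Lemma Rsum_ge_term (I : finType) (P : pred I) (F : I -> R) j :
  (forall i, P i -> 0 <= F i) -> P j -> F j <= \big[Rplus/0]_(i | P i) F i.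
Proof.
move=> F0 Pj; rewrite (bigD1 j) //=.
have : 0 <= \big[Rplus/0]_(i | P i && (i != j)) F i.
  by apply: Rsum_ge0 => i /andP [/F0].
lra.
Qed.

Lemma filterlim_sum (I T : Type) (G : (T -> Prop) -> Prop) {FG : Filter G}
    (r : seq I) (P : pred I) (F : I -> T -> R) (l : I -> R) :
  (forall i, filterlim (F i) G (locally (l i))) ->
  filterlim (fun a => \big[Rplus/0]_(i <- r | P i) F i a) G
    (locally (\big[Rplus/0]_(i <- r | P i) l i)).
Proof.
move=> Fl; elim: r => [|i r IH].
  rewrite big_nil; apply: filterlim_ext (filterlim_const (0 : R)) => a.
  by rewrite big_nil.
rewrite big_cons; case: (boolP (P i)) => Pi.
  apply: (filterlim_ext (fun a => plus (F i a) (\big[Rplus/0]_(i <- r | P i) F i a))).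
    by move=> a; rewrite big_cons Pi.
  apply: filterlim_comp_2 (Fl i) IH _.
  exact: (@filterlim_plus R_AbsRing R_NormedModule).
apply: filterlim_ext IH => a.
by rewrite big_cons (negbTE Pi).
Qed.

Lemma filterlim_prod (T : Type) (G : (T -> Prop) -> Prop) {FG : Filter G}
    (f g : T -> R) (a b : R) :
  filterlim f G (locally a) -> filterlim g G (locally b) ->
  filterlim (fun x => f x * g x) G (locally (a * b)).
Proof.
move=> fa gb; apply: filterlim_comp_2 fa gb _.
exact: (@filterlim_mult R_AbsRing).
Qed.

Lemma filterlim_add (T : Type) (G : (T -> Prop) -> Prop) {FG : Filter G}
    (f g : T -> R) (a b : R) :
  filterlim f G (locally a) -> filterlim g G (locally b) ->
  filterlim (fun x => f x + g x) G (locally (a + b)).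
Proof.
move=> fa gb; apply: filterlim_comp_2 fa gb _.
exact: (@filterlim_plus R_AbsRing R_NormedModule).
Qed.

Lemma filterlim_locally_R (T : Type) (G : (T -> Prop) -> Prop) {FG : Filter G}
    (f : T -> R) (a : R) :
  filterlim f G (locally a) <->
  forall e, 0 < e -> G (fun x => Rabs (f x - a) < e).
Proof.
split=> [fa e e0|H].
  by apply: (fa (fun y => Rabs (y - a) < e)); exists (mkposreal e e0).
move=> P [[e e0] Pe].
by apply: filter_imp (H e e0) => x; apply: Pe.
Qed.

Lemma is_derive_caratheodory (f q : R -> R) x :
  locally x (fun y => f y - f x = q y * (y - x)) ->
  filterlim q (locally x) (locally (q x)) -> is_derive f x (q x).
Proof.
move=> [d fq] /filterlim_locally_R qx; apply/is_derive_Reals => e e0.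
case: (qx e e0) => d' qe.
have d0 : 0 < Rmin d d' by apply: Rmin_pos; [exact: (cond_pos d)|exact: (cond_pos d')].
exists (mkposreal _ d0) => h h0 /= hd.
have hd1 : Rabs (x + h - x) < d.
  by rewrite (_ : x + h - x = h); [apply: Rlt_le_trans hd (Rmin_l _ _)|lra].
have hd2 : Rabs (x + h - x) < d'.
  by rewrite (_ : x + h - x = h); [apply: Rlt_le_trans hd (Rmin_r _ _)|lra].
rewrite (fq (x + h)) //.
rewrite (_ : q (x + h) * (x + h - x) / h - q x = q (x + h) - q x); last by field.
exact: qe.
Qed.

Lemma caratheodory_slope (f : R -> R) x l : is_derive f x l ->
  exists q : R -> R, [/\ q x = l, filterlim q (locally x) (locally l)
    & forall y, f y - f x = q y * (y - x)].
Proof.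
move=> /is_derive_Reals fl.
(* The difference quotient with its removable singularity filled by the derivative. *)
exists (fun y => if Req_dec_T y x then l else (f y - f x) / (y - x)).
split=> [||y].
- by case: (Req_dec_T x x).
- apply/filterlim_locally_R => e e0; case: (fl e e0) => d fd.
  exists d => y yd; case: (Req_dec_T y x) => [yx|yx] /=.
    by rewrite Rminus_diag Rabs_R0.
  have := fd (y - x) _ yd; rewrite (_ : x + (y - x) = y); last by lra.
  by apply; lra.
- by case: (Req_dec_T y x) => [yx|yx] /=; [rewrite yx; lra|field; lra].
Qed.

Section VecTopology.
Variable n : nat.
Implicit Types (x y : vec n) (U : vec n -> Prop).

(** The balls of [cont_at] and [open_set] turned into a filter, so that limits can be composed with
    the general filter lemmas; [open_set U] says by definition that [U] is in the filter of each of
    its points. *)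
Definition vnbhs x (P : vec n -> Prop) : Prop :=
  exists d, 0 < d /\ forall y, (forall i, Rabs (y i - x i) < d) -> P y.

Global Instance vnbhs_filter x : ProperFilter (vnbhs x).
Proof.
split=> [P [d [d0 dP]]|].
  by exists x; apply: dP => i; rewrite Rminus_diag Rabs_R0.
split=> [|P Q [d [d0 dP]] [e [e0 eQ]]|P Q PQ [d [d0 dP]]].
- by exists 1; split=> //; lra.
- exists (Rmin d e); split; first exact: Rmin_pos.
  move=> y ye; split; [apply: dP|apply: eQ] => i; apply: Rlt_le_trans (ye i) _.
    exact: Rmin_l.
  exact: Rmin_r.
- by exists d; split=> // y /dP /PQ.
Qed.

Lemma cont_atE g x : cont_at g x <-> filterlim g (vnbhs x) (locally (g x)).
Proof.
split=> [gx|/filterlim_locally_R gx e e0]; last exact: (gx e e0).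
by apply/filterlim_locally_R => e e0; apply: gx.
Qed.

Lemma vnbhs_coord x i : filterlim (fun y => y i) (vnbhs x) (locally (x i)).
Proof. by apply/filterlim_locally_R => e e0; exists e; split. Qed.

Lemma filterlim_vec (T : Type) (G : (T -> Prop) -> Prop) {FG : Filter G}
    (f : T -> vec n) x :
  (forall i, filterlim (fun a => f a i) G (locally (x i))) ->
  filterlim f G (vnbhs x).
Proof.
move=> fx P [d [d0 dP]]; rewrite /filtermap.
apply: (filter_imp (fun a => forall i, Rabs (f a i - x i) < d)) => [a /dP //|].
by apply: filter_forall_fin => i; move/filterlim_locally_R: (fx i); apply.
Qed.

Lemma upd_id x j : upd x j (x j) = x.
Proof. by apply: functional_extensionality => i; rewrite /upd; case: eqP => [->|]. Qed.

Lemma upd_lim x j : filterlim (upd x j) (locally (x j)) (vnbhs x).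
Proof.
apply: filterlim_vec => i; rewrite /upd; case: eqP => [->|_].
  exact: filterlim_id.
exact: filterlim_const.
Qed.

Lemma upd_near U x j : Defs.open_set U -> U x -> locally (x j) (fun t => U (upd x j t)).
Proof. by move=> oU Ux; apply: (upd_lim x j U); apply: oU. Qed.

Lemma upd_derive x j i :
  is_derive (fun t => upd x j t i) (x j) (if i == j then 1 else 0).
Proof. by rewrite /upd; case: eqP => _; auto_derive. Qed.

Lemma cont_at_ext U g h x : Defs.open_set U -> U x -> (forall y, U y -> g y = h y) ->
  cont_at g x -> cont_at h x.
Proof.
move=> oU Ux gh /cont_atE gx; apply/cont_atE; rewrite -gh //.
by apply: filterlim_ext_loc gx; apply: filter_imp (oU x Ux) => y /gh.
Qed.

Lemma Ck_cont k U g x : Ck k U g -> U x -> cont_at g x.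
Proof. by case: k => [|k] [gc _]; apply: gc. Qed.

Lemma Ck_pred k U g : Ck k.+1 U g -> Ck k U g.
Proof.
elim: k g => [|k IH] g; first by case.
move=> [gc [gd gp]]; split=> //; split=> // j; exact: IH.
Qed.

Lemma Ck_pderiv k U g j : Ck k.+1 U g -> Ck k U (pderiv g j).
Proof. by move=> [_ [_ gp]]; apply: gp. Qed.

Lemma Ck_is_derive k U g x j : Ck k.+1 U g -> U x ->
  is_derive (fun t => g (upd x j t)) (x j) (pderiv g j x).
Proof. by move=> [_ [gd _]] Ux; apply: Derive_correct; apply: gd. Qed.

(** Openness of [U] makes C^k local: the partial derivatives at a point of [U] see only values on a
    neighbourhood inside [U]. This allows formulas valid only on [U] to be exchanged at every
    order. *)
Lemma Ck_ext k U g h : Defs.open_set U -> (forall y, U y -> g y = h y) ->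
  Ck k U g -> Ck k U h.
Proof.
move=> oU; elim: k g h => [|k IH] g h gh.
  by move=> [gc _]; split=> // x Ux; apply: (cont_at_ext U g) (gc x Ux).
move=> [gc [gd gp]]; split; first by move=> x Ux; apply: (cont_at_ext U g) (gc x Ux).
have near x j : U x -> locally (x j) (fun t => g (upd x j t) = h (upd x j t)).
  by move=> Ux; apply: filter_imp (upd_near U x j oU Ux) => t /gh.
split=> [j x Ux|j].
  exact: ex_derive_ext_loc (near x j Ux) (gd j x Ux).
apply: IH (gp j) => y Uy; apply: Derive_ext_loc; exact: near.
Qed.

(** The induction step of all closure lemmas below: explicit candidates [dg] replace [pderiv], with
    which they agree on [U] only. *)
Lemma CkS k U g dg : Defs.open_set U -> (forall x, U x -> cont_at g x) ->
  (forall j x, U x -> is_derive (fun t => g (upd x j t)) (x j) (dg j x)) ->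
  (forall j, Ck k U (dg j)) -> Ck k.+1 U g.
Proof.
move=> oU gc gd dgk; split=> //; split=> [j x Ux|j].
  by exists (dg j x); apply: gd.
apply: Ck_ext (dgk j) => // y Uy.
by symmetry; apply: is_derive_unique; apply: gd.
Qed.

Lemma Ck_const k U c : Defs.open_set U -> Ck k U (fun _ => c).
Proof.
move=> oU; have cc y d : cont_at (fun _ : vec n => d) y.
  by apply/cont_atE; apply: filterlim_const.
elim: k c => [|k IH] c; first by split.
by apply: (CkS k U _ (fun _ _ => 0)) => // j x _; auto_derive.
Qed.

Lemma Ck_coord k U i : Defs.open_set U -> Ck k U (fun x => x i).
Proof.
move=> oU; have cc y : cont_at (fun x : vec n => x i) y.
  by apply/cont_atE; apply: vnbhs_coord.
case: k => [|k]; first by split.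
apply: (CkS k U _ (fun j _ => if i == j then 1 else 0)) => // [j x _|j].
  exact: upd_derive.
exact: Ck_const.
Qed.

Lemma Ck_add k U f g : Defs.open_set U -> Ck k U f -> Ck k U g ->
  Ck k U (fun x => f x + g x).
Proof.
move=> oU; elim: k f g => [|k IH] f g fk gk.
  split=> // x Ux; apply/cont_atE.
  apply: filterlim_add; apply/cont_atE; first exact: Ck_cont fk Ux.
  exact: Ck_cont gk Ux.
apply: (CkS k U _ (fun j x => pderiv f j x + pderiv g j x)) => // [x Ux|j x Ux|j].
- apply/cont_atE.
  apply: filterlim_add; apply/cont_atE; first exact: Ck_cont fk Ux.
  exact: Ck_cont gk Ux.
- apply: (is_derive_plus (V := R_NormedModule)).
    exact: Ck_is_derive fk Ux.
  exact: Ck_is_derive gk Ux.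
- by apply: IH; apply: Ck_pderiv.
Qed.

Lemma Ck_mul k U f g : Defs.open_set U -> Ck k U f -> Ck k U g ->
  Ck k U (fun x => f x * g x).
Proof.
move=> oU; elim: k f g => [|k IH] f g fk gk.
  split=> // x Ux; apply/cont_atE.
  apply: filterlim_prod; apply/cont_atE; first exact: Ck_cont fk Ux.
  exact: Ck_cont gk Ux.
apply: (CkS k U _ (fun j x => pderiv f j x * g x + f x * pderiv g j x)) => // [x Ux|j x Ux|j].
- apply/cont_atE.
  apply: filterlim_prod; apply/cont_atE; first exact: Ck_cont fk Ux.
  exact: Ck_cont gk Ux.
- have := is_derive_mult _ _ _ _ _ (Ck_is_derive _ _ _ _ j fk Ux)
    (Ck_is_derive _ _ _ _ j gk Ux) Rmult_comm.
  by rewrite upd_id.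
- by apply: Ck_add => //; apply: IH => //; first [exact: Ck_pderiv|exact: Ck_pred].
Qed.

Lemma Ck_sum k U (I : Type) (r : seq I) (P : pred I) (F : I -> vec n -> R) :
  Defs.open_set U -> (forall i, Ck k U (F i)) ->
  Ck k U (fun x => \big[Rplus/0]_(i <- r | P i) F i x).
Proof.
move=> oU Fk; elim: r => [|i r IH].
  by apply: Ck_ext (Ck_const k U 0 oU) => // x _; rewrite big_nil.
case: (boolP (P i)) => Pi.
  by apply: Ck_ext (Ck_add _ _ _ _ oU (Fk i) IH) => // x _; rewrite big_cons Pi.
by apply: Ck_ext IH => // x _; rewrite big_cons (negbTE Pi).
Qed.

Lemma cont_at_comp (h : R -> R) g x :
  continuous h (g x) -> cont_at g x -> cont_at (fun y => h (g y)) x.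
Proof.
by move=> hg /cont_atE gx; apply/cont_atE; apply: filterlim_comp gx hg.
Qed.

Lemma Ck_exp k U f : Defs.open_set U -> Ck k U f -> Ck k U (fun x => exp (f x)).
Proof.
move=> oU; elim: k => [|k IH] fk.
  by split=> // x Ux; apply: cont_at_comp (Ck_cont _ _ _ _ fk Ux); apply: continuous_exp.
apply: (CkS k U _ (fun j x => pderiv f j x * exp (f x))) => // [x Ux|j x Ux|j].
- by apply: cont_at_comp (Ck_cont _ _ _ _ fk Ux); apply: continuous_exp.
- have := is_derive_comp exp _ _ _ _ (is_derive_exp _) (Ck_is_derive _ _ _ _ j fk Ux).
  by rewrite upd_id.
- by apply: Ck_mul => //; [exact: Ck_pderiv|apply: IH; exact: Ck_pred].
Qed.

Lemma Ck_inv k U f : Defs.open_set U -> (forall x, U x -> f x <> 0) ->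
  Ck k U f -> Ck k U (fun x => / f x).
Proof.
move=> oU f0; elim: k => [|k IH] fk.
  split=> // x Ux; apply: cont_at_comp (Ck_cont _ _ _ _ fk Ux).
  by apply: continuous_Rinv; apply: f0.
apply: (CkS k U _ (fun j x => (-1 * pderiv f j x) * (/ f x * / f x))) => // [x Ux|j x Ux|j].
- apply: cont_at_comp (Ck_cont _ _ _ _ fk Ux).
  by apply: continuous_Rinv; apply: f0.
- have := is_derive_inv _ _ _ (Ck_is_derive _ _ _ _ j fk Ux).
  rewrite upd_id => /(_ (f0 x Ux)).
  rewrite (_ : - _ / _ = -1 * pderiv f j x * (/ f x * / f x)) //.
  by field; apply: f0.
- apply: Ck_mul => //; last by apply: Ck_mul => //; apply: IH; apply: Ck_pred.
  by apply: Ck_mul => //; [apply: Ck_const|apply: Ck_pderiv].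
Qed.

Lemma Ck_ln k U f : Defs.open_set U -> (forall x, U x -> 0 < f x) ->
  Ck k U f -> Ck k U (fun x => ln (f x)).
Proof.
move=> oU f0 fk.
have lnc x : U x -> cont_at (fun x => ln (f x)) x.
  move=> Ux; apply: cont_at_comp (Ck_cont _ _ _ _ fk Ux).
  by apply: continuous_ln; apply: f0.
case: k fk => [|k] fk; first by split.
apply: (CkS k U _ (fun j x => pderiv f j x * / f x)) => // [j x Ux|j].
- have fx : 0 < f (upd x j (x j)) by rewrite upd_id; apply: f0.
  have := is_derive_comp ln _ _ _ _ (is_derive_ln _ fx) (Ck_is_derive _ _ _ _ j fk Ux).
  by rewrite upd_id.
- apply: Ck_mul => //; first exact: Ck_pderiv.
  apply: Ck_inv => //; last exact: Ck_pred.
  by move=> x Ux; have := f0 x Ux; lra.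
Qed.

Lemma Ck_sqrt k U f : Defs.open_set U -> (forall x, U x -> 0 < f x) ->
  Ck k U f -> Ck k U (fun x => sqrt (f x)).
Proof.
move=> oU f0 fk.
(* Writing the root as an exponential of a logarithm spares a separate induction on k. *)
apply: (Ck_ext _ _ (fun x => exp (/ 2 * ln (f x)))) => // [x Ux|].
  by rewrite -Rpower_sqrt //; apply: f0.
by apply: Ck_exp => //; apply: Ck_mul => //; [apply: Ck_const|apply: Ck_ln].
Qed.

End VecTopology.

(** * The chain rule and smoothness of inverse maps *)

Lemma Rsum_telescope (F : nat -> R) m :
  \big[Rplus/0]_(j < m) (F j.+1 - F j) = F m - F 0%N.
Proof.
elim: m => [|m IH]; first by rewrite big_ord0; lra.
by rewrite big_ord_recr /= IH; lra.
Qed.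

Section MultivariateCalculus.
Variable n : nat.
Implicit Types (x y : vec n) (U V : vec n -> Prop).

(* Moving from [x] to [y] one coordinate at a time reduces increments to the
   one-variable mean value theorem. *)
Definition hybrid (m : nat) x y : vec n := fun i => if (i < m)%N then y i else x i.

Lemma hybrid_upd x y (j : 'I_n) t :
  Rabs (t - x j) <= Rabs (y j - x j) ->
  forall i, Rabs (upd (hybrid j x y) j t i - x i) <= Rabs (y i - x i).
Proof.
move=> tj i; rewrite /upd /hybrid; case: eqP => [->|_] //.
case: ifP => _; first by lra.
by rewrite Rminus_diag Rabs_R0; apply: Rabs_pos.
Qed.

Lemma mvt_pderiv U g x j a b : Defs.open_set U -> Ck 1 U g ->
  (forall t, Rmin a b <= t <= Rmax a b -> U (upd x j t)) ->
  exists2 c, Rmin a b <= c <= Rmax a b &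
    g (upd x j b) - g (upd x j a) = pderiv g j (upd x j c) * (b - a).
Proof.
move=> oU gk segU.
have gd t : Rmin a b <= t <= Rmax a b ->
    is_derive (fun s => g (upd x j s)) t (pderiv g j (upd x j t)).
  move=> tab; have := Ck_is_derive _ _ _ _ _ j gk (segU t tab).
  have E s : upd (upd x j t) j s = upd x j s.
    by apply: functional_extensionality => i; rewrite /upd; case: eqP.
  have -> : upd x j t j = t by rewrite /upd eqxx.
  by apply: is_derive_ext => s; rewrite E.
have [t tab|t tab|c [cab E]] := MVT_gen (fun s => g (upd x j s)) a b
  (fun t => pderiv g j (upd x j t)).
- by apply: gd; lra.
- apply: derivable_continuous_pt; exists (pderiv g j (upd x j t)).
  by apply/is_derive_Reals; apply: gd.
- by exists c.
Qed.

(* Unlike the Frechet remainder, the slopes [q j] turn the chain rule and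
   Cramer's rule for an inverse map into statements about continuity only. *)
Lemma caratheodory U g x : Defs.open_set U -> U x -> Ck 1 U g ->
  exists q : 'I_n -> vec n -> R,
    [/\ (forall j, q j x = pderiv g j x), (forall j, cont_at (q j) x)
      & forall y, g y - g x = \big[Rplus/0]_j (q j y * (y j - x j))].
Proof.
move=> oU Ux gk.
(* The j-th quotient belongs to the move of coordinate j alone. By the mean value theorem it is a
   partial derivative at a point no farther from [x] than [y], whence its continuity at [x]; the
   increments of the moves telescope. *)
pose q (j : 'I_n) y := if Req_dec_T (y j) (x j) then pderiv g j x else
  (g (hybrid j.+1 x y) - g (hybrid j x y)) / (y j - x j).
have hyS (j : 'I_n) y : hybrid j.+1 x y = upd (hybrid j x y) j (y j).
  apply: functional_extensionality => i; rewrite /upd /hybrid.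
  case: eqP => [->|/eqP ij]; first by rewrite ltnSn.
  by rewrite ltnS leq_eqVlt (inj_eq val_inj) (negbTE ij).
have hyj (j : 'I_n) y : hybrid j x y = upd (hybrid j x y) j (x j).
  apply: functional_extensionality => i; rewrite /upd /hybrid.
  by case: eqP => [->|//]; rewrite ltnn.
have qx j : q j x = pderiv g j x by rewrite /q; case: (Req_dec_T (x j) (x j)).
exists q; split=> // [j e e0|y].
- have [r [r0 rU]] := oU x Ux.
  have [d [d0 dg]] := Ck_cont _ _ _ _ _ (Ck_pderiv _ _ _ _ j gk) Ux e e0.
  exists (Rmin r d); split; first exact: Rmin_pos.
  move=> y yr; rewrite qx /q; case: (Req_dec_T (y j) (x j)) => [yx|yx] /=.
    by rewrite Rminus_diag Rabs_R0.
  have close t : Rmin (x j) (y j) <= t <= Rmax (x j) (y j) ->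
      forall i, Rabs (upd (hybrid j x y) j t i - x i) < Rmin r d.
    move=> tj i; apply: Rle_lt_trans (yr i); apply: hybrid_upd.
    move: tj; rewrite /Rmin /Rmax; case: Rle_dec => _ tj; split_Rabs; lra.
  have [t tj E] : exists2 c, Rmin (x j) (y j) <= c <= Rmax (x j) (y j) &
      g (upd (hybrid j x y) j (y j)) - g (upd (hybrid j x y) j (x j)) =
      pderiv g j (upd (hybrid j x y) j c) * (y j - x j).
    apply: (mvt_pderiv U) => // t tj; apply: rU => i.
    by apply: Rlt_le_trans (close t tj i) (Rmin_l _ _).
  rewrite hyS [X in _ - g X]hyj E.
  rewrite (_ : _ * _ / _ = pderiv g j (upd (hybrid j x y) j t)).
    by apply: dg => i; apply: Rlt_le_trans (close t tj i) (Rmin_r _ _).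
  by field; lra.
- have E0 : hybrid 0 x y = x by apply: functional_extensionality.
  have En : hybrid n x y = y.
    by apply: functional_extensionality => i; rewrite /hybrid ltn_ord.
  rewrite -{1}En -{2}E0 -(Rsum_telescope (fun j => g (hybrid j x y))).
  apply: eq_bigr => j _; rewrite /q; case: (Req_dec_T (y j) (x j)) => [yx|yx] /=.
    by rewrite hyS yx -hyj; lra.
  by field; lra.
Qed.

(** Slopes multiply: those of [g] along the curve times those of the coordinates of the curve sum to
    a slope of the composite, continuous at [t]. *)
Lemma chain_rule U g (c : R -> vec n) t (dc : vec n) :
  Defs.open_set U -> U (c t) -> Ck 1 U g ->
  (forall i, is_derive (fun s => c s i) t (dc i)) ->
  is_derive (fun s => g (c s)) t
    (\big[Rplus/0]_j (pderiv g j (c t) * dc j)).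
Proof.
move=> oU Ut gk cd.
have [q [qx qc qE]] := caratheodory _ _ _ oU Ut gk.
have ct : filterlim c (locally t) (vnbhs n (c t)).
  apply: filterlim_vec => i.
  by apply: (ex_derive_continuous (fun s => c s i)); exists (dc i).
have [p pP] : exists p : 'I_n -> R -> R, forall i,
    [/\ p i t = dc i, filterlim (p i) (locally t) (locally (dc i))
      & forall s, c s i - c t i = p i s * (s - t)].
  have /fin_all_exists := fun i => caratheodory_slope _ _ _ (cd i).
  by [].
pose Q s := \big[Rplus/0]_j (q j (c s) * p j s).
have Qt : Q t = \big[Rplus/0]_j (pderiv g j (c t) * dc j).
  by apply: eq_bigr => j _; rewrite qx; case: (pP j) => ->.
rewrite -Qt; apply: is_derive_caratheodory.
  apply: filter_forall => s; rewrite qE /Q [RHS]Rmult_comm Rsum_scal.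
  by apply: eq_bigr => j _; case: (pP j) => _ _ ->; ring.
apply: filterlim_sum => j; apply: filterlim_prod.
  by apply: filterlim_comp ct _; apply/cont_atE.
by case: (pP j) => -> .
Qed.

Lemma Ck_comp k U V g (h : vec n -> vec n) :
  Defs.open_set U -> Defs.open_set V -> (forall y, V y -> U (h y)) ->
  Ck k U g -> (forall i, Ck k V (fun y => h y i)) ->
  Ck k V (fun y => g (h y)).
Proof.
move=> oU oV hU.
have gc m g' y : Ck m U g' -> (forall i, Ck m V (fun y => h y i)) -> V y ->
    cont_at (fun y => g' (h y)) y.
  move=> gk hk Vy; apply/cont_atE.
  apply: (filterlim_comp _ _ _ h g' _ (vnbhs n (h y))).
    by apply: filterlim_vec => i; apply/cont_atE; apply: (Ck_cont _ _ _ _ _ (hk i)).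
  by apply/cont_atE; apply: (Ck_cont _ _ _ _ _ gk); apply: hU.
elim: k g => [|k IH] g gk hk; first by split=> // y; apply: gc gk hk.
have g1 : Ck 1 U g.
  by elim: {IH hk} k gk => // k IH gk; apply: IH; exact: Ck_pred.
apply: (CkS _ k V _ (fun j y => \big[Rplus/0]_i
  (pderiv g i (h y) * pderiv (fun z => h z i) j y))) => // [y|j y Vy|j].
- exact: gc gk hk.
- have := chain_rule U g (fun t => h (upd y j t)) (y j)
    (fun i => pderiv (fun z => h z i) j y) oU.
  rewrite upd_id; apply=> //; first exact: hU.
  by move=> i; apply: (Ck_is_derive _ _ _ _ _ j (hk i)).
- apply: Ck_sum => // i; apply: Ck_mul => //; last exact: Ck_pderiv (hk i).
  apply: IH; first exact: Ck_pderiv.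
  by move=> l; apply: Ck_pred.
Qed.

(** With M(z) the slope matrix of [f] between g(y) and g(z), one has z - y = M(z) (g(z) - g(y)), and
    M tends to the Jacobian because [g] is continuous. Inverting M gives the partial derivatives of
    [g]; they involve [g] only through the Jacobian of [f] at g(y), so C^k for [g] yields
    C^(k+1). *)
Lemma inverse_smooth U V (f g : vec n -> vec n) :
  Defs.open_set U -> Defs.open_set V -> smooth_map U f ->
  (forall y, V y -> U (g y)) -> (forall y, V y -> f (g y) = y) ->
  (forall y i, V y -> cont_at (fun z => g z i) y) ->
  (forall x, U x -> forall v : vec n,
     (forall i, \big[Rplus/0]_j (pderiv (fun z => f z i) j x * v j) = 0) ->
     forall i, v i = 0) ->
  smooth_map V g.
Proof.
move=> oU oV fs gU fg gc inj i k.
pose J y (i j : 'I_n) := pderiv (fun z => f z i) j (g y).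
have detJ y : V y -> Cramer.det (J y) <> 0.
  by move=> Vy; apply: Cramer.det_neq0; apply: inj; apply: gU.
elim: k i => [|k IH] i; first by split=> // y Vy; apply: gc.
apply: (CkS _ k V _ (fun j y => Cramer.adj (J y) i j * / Cramer.det (J y)))
  => // [y|j y Vy|j]; first exact: gc.
- have Ugy := gU y Vy.
  have /fin_all_exists [q qP] := fun i => caratheodory _ _ _ oU Ugy (fs i 1%N).
  pose M z (a b : 'I_n) := q a b (g z).
  have MJ : M y = J y.
    apply: functional_extensionality => a; apply: functional_extensionality => b.
    by rewrite /M; case: (qP a) => ->.
  pose slope t := Cramer.adj (M (upd y j t)) i j * / Cramer.det (M (upd y j t)).
  have gy : filterlim g (vnbhs n y) (vnbhs n (g y)).
    by apply: filterlim_vec => a; apply/cont_atE; apply: gc.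
  have Mc a b : cont_at (fun z => M z a b) y.
    apply/cont_atE; apply: filterlim_comp gy _; apply/cont_atE.
    by case: (qP a).
  have [cC cA cM] : [/\ forall c : R, cont_at (fun _ : vec n => c) y,
    forall u v : vec n -> R, cont_at u y -> cont_at v y ->
      cont_at (fun z => u z + v z) y &
    forall u v : vec n -> R, cont_at u y -> cont_at v y ->
      cont_at (fun z => u z * v z) y].
    split=> [c|u v /cont_atE uc /cont_atE vc|u v /cont_atE uc /cont_atE vc];
      apply/cont_atE.
    - exact: filterlim_const.
    - exact: filterlim_add.
    - exact: filterlim_prod.
  have dc : cont_at (fun z => Cramer.det (M z)) y.
    exact: (Cramer.det_closed _ (fun u => cont_at u y)).
  have ac : cont_at (fun z => Cramer.adj (M z) i j) y.
    exact: (Cramer.adj_closed _ (fun u => cont_at u y)).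
  have sc : filterlim slope (locally (y j)) (locally (slope (y j))).
    apply: (filterlim_comp _ _ _ (upd y j)
      (fun z => Cramer.adj (M z) i j * / Cramer.det (M z)) _ (vnbhs n y)).
      exact: upd_lim.
    rewrite /slope upd_id; apply/cont_atE; apply: cM => //.
    apply: cont_at_comp dc; apply: continuous_Rinv; rewrite MJ; exact: detJ.
  have E : slope (y j) = Cramer.adj (J y) i j * / Cramer.det (J y).
    by rewrite /slope upd_id MJ.
  rewrite -E; apply: is_derive_caratheodory => //.
  (* The hypothesis on the Jacobian gives invertibility at [y] alone; continuity of the determinant
     extends it to nearby slope matrices. *)
  have dnear : locally (y j) (fun t => Cramer.det (M (upd y j t)) <> 0).
    apply: (upd_lim _ y j (fun z => Cramer.det (M z) <> 0)).
    have /cont_atE/filterlim_locally_R := dc.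
    rewrite MJ => /(_ (Rabs (Cramer.det (J y)))) dn.
    apply: filter_imp (dn (Rabs_pos_lt _ (detJ y Vy))) => z.
    by move=> h z0; move: h; rewrite z0 Rminus_0_l Rabs_Ropp; lra.
  apply: filter_imp (filter_and _ _ dnear (upd_near _ _ _ j oV Vy)) => t [dt Vt].
  rewrite upd_id /slope; set z := upd y j t in dt Vt *.
  have := Cramer.adj_mul _ (M z) (fun b => g z b - g y b) i.
  under eq_bigr => a _.
    have -> : \big[Rplus/0]_b (M z a b * (g z b - g y b)) = z a - y a.
      by case: (qP a) => _ _ /(_ (g z)) <-; rewrite !fg.
  over.
  (* Only coordinate j of z - y is nonzero, so a single cofactor survives. *)
  rewrite (bigD1 j) //= big1 => [|a aj]; last first.
    by rewrite /z /upd (negbTE aj); ring.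
  have -> : z j = t by rewrite /z /upd eqxx.
  rewrite Rplus_0_r => eq.
  apply: (Rmult_eq_reg_l (Cramer.det (M z))) => //.
  by rewrite -eq; field.
- have JC a b : Ck k V (fun y => J y a b).
    apply: (Ck_comp k U V (pderiv (fun z => f z a) b) g) => //.
    exact: Ck_pderiv (fs a k.+1).
  have cC c : Ck k V (fun _ => c) by apply: Ck_const.
  have cA u v : Ck k V u -> Ck k V v -> Ck k V (fun z => u z + v z) by apply: Ck_add.
  have cM u v : Ck k V u -> Ck k V v -> Ck k V (fun z => u z * v z) by apply: Ck_mul.
  apply: (cM); first exact: (Cramer.adj_closed _ (Ck k V)).
  apply: Ck_inv => //; exact: (Cramer.det_closed _ (Ck k V)).
Qed.

End MultivariateCalculus.

(** * Proper maps with negative definite Jacobian *)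

(** The extraction [phi] is only required to tend to infinity, not to be increasing: this suffices
    for limits and is stable under composition, as the coordinatewise extraction for vectors
    needs. *)
Lemma bounded_subseq (u : nat -> R) a b : (forall k, a <= u k <= b) ->
  exists phi : nat -> nat, filterlim phi eventually eventually /\
    exists l : R, filterlim (fun k => u (phi k)) eventually (locally l).
Proof.
move=> uab; have [l ul] := Bolzano_Weierstrass u _ (compact_P3 a b) uab.
have H k : exists p, (k <= p)%coq_nat /\ Rabs (u p - l) < / (INR k + 1).
  have k0 : 0 < / (INR k + 1) by apply: Rinv_0_lt_compat; have := pos_INR k; lra.
  have [|p [kp pl]] := ul (fun x => Rabs (x - l) < / (INR k + 1)) k.
    by exists (mkposreal _ k0).
  by exists p.
exists (fun k => epsilon (inhabits 0%N)
   (fun p => (k <= p)%coq_nat /\ Rabs (u p - l) < / (INR k + 1))).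
have phiP k := epsilon_spec (inhabits 0%N) _ (H k).
split.
  move=> P [N NP]; exists N => k Nk; apply: NP.
  exact: PeanoNat.Nat.le_trans Nk (proj1 (phiP k)).
exists l; apply/filterlim_locally_R => e e0.
have [N Ne] := archimed_cor1 e e0.
exists N => k Nk; apply: Rlt_trans (proj2 (phiP k)) _.
case: Ne => Ne N0; apply: Rle_lt_trans Ne; apply: Rinv_le_contravar.
  by apply: lt_0_INR.
by have := le_INR _ _ Nk; lra.
Qed.

Lemma bounded_subseq_vec n (u : nat -> vec n) R :
  (forall k i, Rabs (u k i) <= R) ->
  exists phi : nat -> nat, filterlim phi eventually eventually /\
    exists l : vec n, filterlim (fun k => u (phi k)) eventually (vnbhs n l).
Proof.
move=> uR.
have H (s : seq 'I_n) : exists phi : nat -> nat,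
    filterlim phi eventually eventually /\ exists l : vec n, forall i, i \in s ->
      filterlim (fun k => u (phi k) i) eventually (locally (l i)).
  elim: s => [|i s [phi [phioo [l ul]]]].
    by exists id; split; [exact: filterlim_id|exists (fun=> 0)].
  have [|chi [choo [m um]]] := bounded_subseq (fun k => u (phi k) i) (- R) R.
    by move=> k; have := uR (phi k) i; move/Rabs_le_between.
  exists (fun k => phi (chi k)); split; first exact: filterlim_comp choo phioo.
  exists (upd l i m) => j; rewrite inE /upd.
  case: eqP => [-> //|_ /= js].
  exact: filterlim_comp choo (ul j js).
have [phi [phioo [l ul]]] := H (enum 'I_n).
exists phi; split=> //; exists l; apply: filterlim_vec => i.
by apply: ul; rewrite mem_enum.
Qed.

Lemma filterlim_le_const (u : nat -> R) m l :
  filterlim u eventually (locally l) -> (forall k, m <= u k) -> m <= l.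
Proof.
move=> ul mu; apply: Rnot_lt_le => lm.
have e0 : 0 < m - l by lra.
have [N NP] := proj1 (filterlim_locally_R _ _ _ _) ul _ e0.
by have /Rabs_def2 := NP N (le_n N); have := mu N; lra.
Qed.

Lemma is_derive_Rsum (I : Type) (r : seq I) (F : I -> R -> R) t (d : I -> R) :
  (forall i, is_derive (F i) t (d i)) ->
  is_derive (fun s => \big[Rplus/0]_(i <- r) F i s) t (\big[Rplus/0]_(i <- r) d i).
Proof.
move=> Fd; elim: r => [|i r IH].
  rewrite big_nil; apply: is_derive_ext (is_derive_const 0 t) => s.
  by rewrite big_nil.
rewrite big_cons; apply: is_derive_ext (is_derive_plus _ _ _ _ _ (Fd i) IH) => s.
by rewrite big_cons.
Qed.

Lemma is_derive_local_min (g : R -> R) t d :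
  is_derive g t d -> locally t (fun s => g t <= g s) -> d = 0.
Proof.
move=> /is_derive_Reals gd [[e e0] gmin].
have pr : derivable_pt g t by exists d.
rewrite -(derive_pt_eq_0 _ _ _ pr gd).
apply: (deriv_minimum g (t - e) (t + e)) => [||s s1 s2]; try lra.
apply: gmin; rewrite /ball /= /AbsRing_ball /abs /minus /plus /opp /=.
by apply: Rabs_def1; lra.
Qed.

Section ProperMonotone.
Variables (n : nat) (W : vec n -> Prop) (f : vec n -> vec n).
Let pos (B : vec n) := forall i, 0 < B i.
Let line (x v : vec n) (t : R) : vec n := fun i => x i + t * v i.

Hypothesis W_open : Defs.open_set W.
Hypothesis W_nonempty : exists w, W w.
Hypothesis W_convex : forall x y t, W x -> W y -> 0 <= t <= 1 ->
  W (fun i => x i + t * (y i - x i)).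
Hypothesis f_smooth : smooth_map W f.
Hypothesis f_pos : forall w, W w -> pos (f w).
Hypothesis f_neg : forall w v, W w -> (exists i, v i <> 0) ->
  \big[Rplus/0]_i
    (v i * \big[Rplus/0]_j (pderiv (fun x => f x i) j w * v j)) < 0.
Hypothesis f_proper : forall e K (u : nat -> vec n), 0 < e ->
  (forall k, W (u k)) -> (forall k i, e <= f (u k) i <= K) ->
  exists phi : nat -> nat, filterlim phi eventually eventually /\
    exists2 l, W l & filterlim (fun k => u (phi k)) eventually (vnbhs n l).

Lemma line_derive x v t i : W (line x v t) ->
  is_derive (fun s => f (line x v s) i) t
    (\big[Rplus/0]_j (pderiv (fun x => f x i) j (line x v t) * v j)).
Proof.
move=> Wt; apply: (chain_rule _ W (fun x => f x i) (line x v) t v) => //.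
by move=> j; rewrite /line; auto_derive => //; ring.
Qed.

(** On the segment from [x] to [y], the pairing of [f] with v = y - x has negative derivative, yet
    equal values of [f] at the ends would make it return to its initial value. *)
Lemma proper_monotone_inj x y : W x -> W y -> f x = f y -> x = y.
Proof.
move=> Wx Wy fxy; apply: NNPP => xy.
pose v : vec n := fun i => y i - x i.
have v0 : exists i, v i <> 0.
  apply: NNPP => v0; apply: xy; apply: functional_extensionality => i.
  by have := not_ex_all_not _ _ v0 i; rewrite /v; lra.
have Wl t : 0 <= t <= 1 -> W (line x v t) by move=> t01; exact: W_convex.
pose g t := \big[Rplus/0]_i (v i * f (line x v t) i).
have gd t : 0 <= t <= 1 -> is_derive g t (\big[Rplus/0]_i (v i *
    \big[Rplus/0]_j (pderiv (fun x => f x i) j (line x v t) * v j))).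
  move=> t01; apply: is_derive_Rsum => i.
  by apply: is_derive_scal; apply: line_derive; apply: Wl.
have [||c [c01 gc]] := MVT_gen g 0 1 (fun t => \big[Rplus/0]_i (v i *
    \big[Rplus/0]_j (pderiv (fun x => f x i) j (line x v t) * v j))).
- by move=> t; rewrite Rmin_left ?Rmax_right; try lra; move=> ?; apply: gd; lra.
- move=> t; rewrite Rmin_left ?Rmax_right; try lra; move=> t01.
  apply: derivable_continuous_pt; eexists; apply/is_derive_Reals; exact: gd.
move: c01; rewrite Rmin_left ?Rmax_right; try lra; move=> c01.
have := f_neg _ _ (Wl c c01) v0.
have g01 : g 1 = g 0.
  apply: eq_bigr => i _; congr (_ * _).
  have -> : line x v 1 = y by apply: functional_extensionality => j; rewrite /line /v; ring.
  have -> : line x v 0 = x by apply: functional_extensionality => j; rewrite /line /v; ring.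
  by rewrite fxy.
lra.
Qed.

(* [G] blows up both when some [f w i] tends to [0] and when it tends to infinity,
   so its sublevel sets are covered by [f_proper]. *)
Lemma comparison_min_exists (B : vec n) : pos B ->
  let G w := \big[Rplus/0]_i (f w i / B i + B i / f w i) in
  exists2 l, W l & forall w, W w -> G l <= G w.
Proof.
move=> B0 G.
have term0 w i : W w -> 0 < f w i / B i /\ 0 < B i / f w i.
  by move=> Ww; split; apply: Rdiv_lt_0_compat; first [exact: B0|exact: f_pos].
have G0 w : W w -> 0 <= G w.
  by move=> Ww; apply: Rsum_ge0 => i _; have := term0 w i Ww; lra.
(* The infimum of [G] is obtained as - m, with m the supremum of - G. *)
have [m [mub mleast]] : { m | is_lub (fun r => exists2 w, W w & r = - G w) m }.
  apply: completeness.
    by exists 0 => r [w Ww ->]; have := G0 w Ww; lra.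
  by case: W_nonempty => w Ww; exists (- G w); exists w.
have H k : exists w, W w /\ G w < - m + / (INR k + 1).
  apply: NNPP => none.
  have k0 : 0 < / (INR k + 1) by apply: Rinv_0_lt_compat; have := pos_INR k; lra.
  have : m <= m - / (INR k + 1); last by lra.
  apply: mleast => r [w Ww ->].
  have := not_ex_all_not _ _ none w => nw.
  have : ~ (G w < - m + / (INR k + 1)) by move=> ?; apply: nw.
  by lra.
pose u k := epsilon (inhabits (fun _ : 'I_n => 0))
  (fun w => W w /\ G w < - m + / (INR k + 1)).
have uP k : W (u k) /\ G (u k) < - m + / (INR k + 1) := epsilon_spec _ _ (H k).
have uW k := proj1 (uP k).
pose c := - m + 1.
have uc k : G (u k) <= c.
  have [_ ?] := uP k; have : / (INR k + 1) <= / 1; last by rewrite /c; lra.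
  by apply: Rinv_le_contravar; have := pos_INR k; lra.
have termc k i : f (u k) i / B i <= c /\ B i / f (u k) i <= c.
  have [? ?] := term0 _ i (uW k).
  have := uc k.
  have : f (u k) i / B i + B i / f (u k) i <= G (u k); last by lra.
  apply: (Rsum_ge_term _ predT (fun i => f (u k) i / B i + B i / f (u k) i)) => //.
  by move=> j _; have := term0 _ j (uW k); lra.
have [K [K0 KP]] : exists K, 0 < K /\ forall i : 'I_n, c * B i <= K /\ c / B i <= K.
  have : Rbar_locally p_infty
      (fun K => 0 < K /\ forall i : 'I_n, c * B i <= K /\ c / B i <= K).
    apply: filter_and; first by exists 0.
    apply: filter_forall_fin => i.
    apply: filter_and; [exists (c * B i)|exists (c / B i)] => y; lra.
  by move=> [M MP]; exists (M + 1); apply: MP; lra.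
have [||k i|phi [phioo [l Wl ul]]] := f_proper (/ K) K u.
- exact: Rinv_0_lt_compat.
- exact: uW.
- have [t1 t2] := termc k i; have [K1 K2] := KP i; have Bi := B0 i.
  have fi := f_pos _ (uW k) i.
  split; last first.
    apply: Rle_trans K1.
    have -> : f (u k) i = (f (u k) i / B i) * B i by field; lra.
    by apply: Rmult_le_compat_r => //; lra.
  rewrite -(Rinv_inv (f (u k) i)); apply: Rinv_le_contravar; first exact: Rinv_0_lt_compat.
  apply: Rle_trans K2.
  have -> : / f (u k) i = (B i / f (u k) i) / B i by field; lra.
  by apply: Rmult_le_compat_r => //; apply: Rlt_le; apply: Rinv_0_lt_compat.
exists l => // w Ww.
apply: (Rle_trans _ (- m)); last first.
  by have : - G w <= m; [apply: mub; exists w|lra].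
have Gl : filterlim (fun k => G (u (phi k))) eventually (locally (G l)).
  apply: filterlim_comp ul _.
  apply: (filterlim_sum _ _ (vnbhs n l) _ _ (fun i w => f w i / B i + B i / f w i)) => i.
  have fi : filterlim (fun x => f x i) (vnbhs n l) (locally (f l i)).
    by apply/cont_atE; apply: (Ck_cont _ _ _ _ _ (f_smooth i 0%N)).
  apply: filterlim_add; apply: filterlim_prod => //; try exact: filterlim_const.
  apply: filterlim_comp fi _; apply: continuous_Rinv.
  by have := f_pos _ Wl i; lra.
apply: Rnot_lt_le => mG.
have e0 : 0 < (G l + m) / 2 by lra.
have [N1 N1P] := proj1 (filterlim_locally_R _ _ _ _) Gl _ e0.
have [N2 [N2P N20]] := archimed_cor1 _ e0.
have [N3 N3P] := phioo (fun k => (N2 <= k)%coq_nat) (ex_intro _ N2 (fun k h => h)).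
pose k := (Nat.max N1 N3).
have := N1P k (PeanoNat.Nat.le_max_l _ _).
have /le_INR Nk := N3P k (PeanoNat.Nat.le_max_r _ _).
have [_ Gk] := uP (phi k).
have : / (INR (phi k) + 1) <= / INR N2.
  apply: Rinv_le_contravar; first exact: lt_0_INR.
  by lra.
by move=> ? /Rabs_def2 [? ?]; lra.
Qed.

Lemma proper_monotone_surj (B : vec n) : pos B -> exists2 w, W w & f w = B.
Proof.
move=> B0; have [l Wl lmin] := comparison_min_exists B B0.
exists l => //; apply: functional_extensionality => i.
(* This is the gradient of the comparison function with respect to the values of [f]. Taking it also
   as the direction of motion in [W] makes the derivative exactly the quadratic form of the Jacobian
   at [v]. *)
pose v : vec n := fun i => / B i - B i / (f l i)^2.
have fl0 i := f_pos _ Wl i.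
suff v0 : v i = 0.
  have Bi := B0 i; have fi := fl0 i.
  have : (f l i - B i) * (f l i + B i) = 0.
    have -> : (f l i - B i) * (f l i + B i) = v i * (B i * (f l i)^2) by rewrite /v; field; lra.
    by rewrite v0; ring.
  by case/Rmult_integral; lra.
apply: NNPP => vi0.
have line0 : line l v 0 = l by apply: functional_extensionality => j; rewrite /line; ring.
pose d i := \big[Rplus/0]_j (pderiv (fun x => f x i) j l * v j).
have fd j : is_derive (fun t => f (line l v t) j) 0 (d j).
  by have := line_derive l v 0 j; rewrite line0; apply.
have Gd : is_derive (fun t => \big[Rplus/0]_i (f (line l v t) i / B i + B i / f (line l v t) i)) 0
    (\big[Rplus/0]_i (v i * d i)).
  apply: is_derive_Rsum => j.
  have fj : f (line l v 0) j <> 0 by rewrite line0; have := fl0 j; lra.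
  have := is_derive_plus _ _ _ _ _ (is_derive_scal _ _ (/ B j) _ (fd j))
    (is_derive_scal _ _ (B j) _ (is_derive_inv _ _ _ (fd j) fj)).
  have -> : plus (/ B j * d j) (B j * (- d j / f (line l v 0) j ^ 2)) = v j * d j.
    rewrite line0 /plus /= /v; field; have := fl0 j; have := B0 j; lra.
  by apply: is_derive_ext => t; rewrite /plus /= /Rdiv; ring.
have := f_neg l v Wl; rewrite -/d => neg.
have := is_derive_local_min _ _ _ Gd; rewrite line0 => dmin.
suff : \big[Rplus/0]_i (v i * d i) = 0 by have := neg (ex_intro _ i vi0); rewrite /d; lra.
apply: dmin.
have : locally 0 (fun t => W (line l v t)).
  have ll : filterlim (line l v) (locally 0) (vnbhs n l).
    apply: filterlim_vec => j; rewrite -{2}line0.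
    apply: (ex_derive_continuous (fun t => l j + t * v j)); auto_derive; done.
  by apply: ll; apply: W_open.
by apply: filter_imp => t /lmin.
Qed.

Lemma proper_monotone_diffeo : diffeo_onto W pos f.
Proof.
have posO : Defs.open_set pos.
  move=> B B0; apply: (filter_forall_fin _ _ (vnbhs n B) (fun i y => 0 < y i)) => i.
  by exists (B i); split=> [|y /(_ i) /Rabs_def2 [? ?]]; [exact: B0|lra].
pose g (B : vec n) := epsilon (inhabits (fun _ : 'I_n => 0)) (fun w => W w /\ f w = B).
have gP B : pos B -> W (g B) /\ f (g B) = B.
  move=> B0; apply: (epsilon_spec _ (fun w => W w /\ f w = B)).
  by have [w Ww fw] := proper_monotone_surj B B0; exists w.
split=> //; exists g.
have gf x : W x -> g (f x) = x.
  by move=> Wx; have [Wg fg] := gP _ (f_pos x Wx); apply: proper_monotone_inj.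
split=> [y /gP []//|x Wx i|y y0 i|]; first by rewrite gf.
  by case: (gP y y0) => _ ->.
apply: (inverse_smooth _ W pos f g) => // [y /gP []//|y /gP []//|y i y0|x Wx v Jv i].
(* Continuity of the inverse at [y]: otherwise some z_k tend to [y] while g(z_k) stays away from
   g(y). By [f_proper] a subsequence of g(z_k) converges to some [l] in [W]; continuity of [f] gives
   f(l) = y, so injectivity forces l = g(y). *)
- apply: NNPP => ncont.
  have [e [e0 bad]] : exists e, 0 < e /\ forall d, 0 < d -> exists z,
      (forall j, Rabs (z j - y j) < d) /\ e <= Rabs (g z i - g y i).
    apply: NNPP => h; apply: ncont => e e0.
    apply: NNPP => h'; apply: h; exists e; split=> // d d0.
    apply: NNPP => h''; apply: h'; exists d; split=> // z zd.
    apply: Rnot_le_lt => ez; apply: h''; by exists z.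
  (* With [r] at most half of each coordinate, all points within [r] of [y] have coordinates at
     least [r], as [f_proper] requires. *)
  have [r [r0 rP]] : exists r, 0 < r /\ forall j : 'I_n, r <= y j / 2.
    have : at_right 0 (fun r => 0 < r /\ forall j : 'I_n, r <= y j / 2).
      apply: filter_and; first by exists (mkposreal 1 Rlt_0_1).
      apply: filter_forall_fin => j.
      have y2 : 0 < y j / 2 by have := y0 j; lra.
      exists (mkposreal _ y2) => s /=.
      rewrite /ball /= /AbsRing_ball /abs /minus /plus /opp /=.
      by move=> /Rabs_def2 [? ?] _; lra.
    move=> [d dP]; exists (d / 2); apply: dP; last by case: d => /= *; lra.
    rewrite /ball /= /AbsRing_ball /abs /minus /plus /opp /=.
    by case: d => /= d d0; apply: Rabs_def1; lra.
  have [K KP] : exists K, forall j : 'I_n, y j + r <= K.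
    have : Rbar_locally p_infty (fun K => forall j : 'I_n, y j + r <= K).
      by apply: filter_forall_fin => j; exists (y j + r) => s; lra.
    by move=> [M MP]; exists (M + 1); apply: MP; lra.
  have step k : 0 < Rmin r (/ (INR k + 1)).
    by apply: Rmin_pos => //; apply: Rinv_0_lt_compat; have := pos_INR k; lra.
  pose z k := epsilon (inhabits (fun _ : 'I_n => 0)) (fun z =>
    (forall j, Rabs (z j - y j) < Rmin r (/ (INR k + 1))) /\ e <= Rabs (g z i - g y i)).
  have zP k : (forall j, Rabs (z k j - y j) < Rmin r (/ (INR k + 1))) /\
      e <= Rabs (g (z k) i - g y i) := epsilon_spec _ _ (bad _ (step k)).
  have zr k j : Rabs (z k j - y j) < r.
    by apply: Rlt_le_trans (Rmin_l _ _); apply: (proj1 (zP k)).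
  have z0 k : pos (z k).
    by move=> j; have /Rabs_def2 := zr k j; have := rP j; lra.
  have zy : filterlim z eventually (vnbhs n y).
    apply: filterlim_vec => j; apply/filterlim_locally_R => d d0.
    have [N [Nd N0]] := archimed_cor1 d d0; exists N => k /le_INR Nk.
    apply: Rlt_trans (proj1 (zP k) j) _; apply: Rle_lt_trans (Rmin_r _ _) _.
    apply: Rle_lt_trans Nd; apply: Rinv_le_contravar; first exact: lt_0_INR.
    by lra.
  have [||k j|phi [phioo [l Wl gl]]] := f_proper r K (fun k => g (z k)).
  + exact: r0.
  + by move=> k; case: (gP _ (z0 k)).
  + rewrite (proj2 (gP _ (z0 k))).
    by have /Rabs_def2 := zr k j; have := rP j; have := KP j; lra.
  have fl : f l = y.
    apply: functional_extensionality => j.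
    apply: (filterlim_locally_unique (F := eventually) (fun k => z (phi k) j)).
      apply: (filterlim_ext (fun k => f (g (z (phi k))) j)).
        by move=> k; rewrite (proj2 (gP _ (z0 _))).
      apply: (filterlim_comp _ _ _ (fun k => g (z (phi k))) (fun w => f w j) _ _ _ gl).
      by apply/cont_atE; apply: (Ck_cont _ _ _ _ _ (f_smooth j 0%N)).
    apply: (filterlim_comp _ _ _ phi (fun k => z k j) _ _ _ phioo).
    exact: (filterlim_comp _ _ _ z (fun w => w j) _ _ _ zy (vnbhs_coord _ _ _)).
  have gyl : g y = l by rewrite -fl gf.
  have /filterlim_locally_R := filterlim_comp _ _ _ _ (fun w : vec n => w i)
    _ _ _ gl (vnbhs_coord _ _ _).
  move=> /(_ e e0) [N NP]; have := NP N (le_n N).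
  by rewrite -gyl; have := proj2 (zP (phi N)); lra.
- apply: NNPP => vi; have := f_neg x v Wx (ex_intro _ i vi).
  rewrite big1 => [|j _]; first by lra.
  by rewrite Jv Rmult_0_r.
Qed.

End ProperMonotone.

(** * Right-angled hexagons *)

Lemma cosh_sub1 x : cosh x - 1 = (exp x - 1)^2 / (2 * exp x).
Proof. by rewrite /cosh exp_Ropp; field; have := exp_pos x; lra. Qed.

Lemma cosh_ge1 x : 1 <= cosh x.
Proof.
have := cosh_sub1 x; have e0 := exp_pos x.
have : 0 <= (exp x - 1)^2 / (2 * exp x).
  by apply: Rdiv_le_0_compat; [apply: pow2_ge_0|lra].
by lra.
Qed.

Lemma cosh_gt1 x : x <> 0 -> 1 < cosh x.
Proof.
move=> x0; have := cosh_sub1 x; have e0 := exp_pos x.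
have : 0 < (exp x - 1)^2 / (2 * exp x).
  apply: Rdiv_lt_0_compat; last lra.
  apply: pow2_gt_0 => e1; apply: x0; apply: exp_inv.
  by rewrite exp_0; lra.
by lra.
Qed.

Lemma ln_sqrt x : 0 < x -> ln (sqrt x) = / 2 * ln x.
Proof. by move=> x0; rewrite -Rpower_sqrt // /Rpower ln_exp. Qed.

Lemma acosh_spec z : 1 <= z ->
  [/\ 0 <= acosh z, cosh (acosh z) = z & sinh (acosh z) = sqrt (z * z - 1)].
Proof.
move=> z1; set r := sqrt (z * z - 1).
have r0 : 0 <= r by apply: sqrt_pos.
have rr : r * r = z * z - 1 by apply: sqrt_sqrt; nra.
have ea : exp (acosh z) = z + r by rewrite exp_ln // -/r; lra.
have ei : / (z + r) = z - r.
  by apply: (Rmult_eq_reg_l (z + r)); [rewrite Rinv_r; nra|lra].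
split; rewrite /cosh /sinh ?exp_Ropp ?ea ?ei; try lra.
rewrite /acosh -/r -ln_1; case: (Req_dec (z + r) 1) => [->|]; first lra.
by move=> ?; apply: Rlt_le; apply: ln_increasing; lra.
Qed.

Lemma acosh_pos z : 1 < z -> 0 < acosh z.
Proof.
move=> z1; rewrite /acosh -ln_1; apply: ln_increasing; first lra.
by have := sqrt_pos (z * z - 1); lra.
Qed.

Lemma cosh_double x : cosh (2 * x) = 2 * (cosh x)^2 - 1.
Proof.
rewrite /cosh (_ : 2 * x = x + x); last ring.
rewrite Ropp_plus_distr !exp_plus exp_Ropp; field; have := exp_pos x; lra.
Qed.

Lemma sinh_ge0 x : 0 <= x -> 0 <= sinh x.
Proof.
move=> [x0|<-]; last by rewrite sinh_0; lra.
by apply: Rlt_le; rewrite -sinh_0; apply: sinh_lt.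
Qed.

Lemma sinh_sqrt x : 0 <= x -> sinh x = sqrt ((cosh x)^2 - 1).
Proof.
move=> x0; rewrite (_ : _ - 1 = (sinh x)^2); first by rewrite sqrt_pow2 //; exact: sinh_ge0.
rewrite /cosh /sinh exp_Ropp; field; have := exp_pos x; lra.
Qed.

(* [a], [b], [c] are the hyperbolic cosines of the three edges of a hexagon,
   [a] that of the edge opposite to the arc; [gram] is minus the determinant
   of the Gram matrix of the hexagon. *)
Definition gram (a b c : R) : R := a^2 + b^2 + c^2 + 2 * a * b * c - 1.

(** The inverse hyperbolic cosine from the hexagon cosine rule with its logarithm split, so that all
    denominators become separate logarithms. *)
Definition arc (a b c : R) : R :=
  ln (a + b * c + sqrt (gram a b c)) - / 2 * ln (b^2 - 1) - / 2 * ln (c^2 - 1).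

(** The variation of [arc] when the conformal factors move at rates [v1], [v2], [v3] at the corners
    opposite to the edges [a], [b], [c]; the factors b + 1 and c + 1 of the edge variations have
    cancelled against b^2 - 1 and c^2 - 1. *)
Definition darc (a b c v1 v2 v3 : R) : R :=
  2 * / sqrt (gram a b c) * ((a + 1) * (v2 + v3)
    - (c + a * b) / (b - 1) * (v3 + v1) - (b + a * c) / (c - 1) * (v1 + v2)).

Section Hexagon.
Variables a b c : R.
Hypotheses (a1 : 1 < a) (b1 : 1 < b) (c1 : 1 < c).

Lemma gram_gt1 : 1 < gram a b c.
Proof.
have ab : 0 < a * b by nra.
by rewrite /gram; nra.
Qed.

Let z := (a + b * c) / (sqrt (b^2 - 1) * sqrt (c^2 - 1)).

(** Rests on (a + b c)^2 - (b^2 - 1) (c^2 - 1) = [gram a b c], which is positive. *)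
Lemma hexagon_cosh_spec : 1 < z /\ z * z - 1 = gram a b c / ((b^2 - 1) * (c^2 - 1)).
Proof.
have b0 : 0 < b^2 - 1 by nra.
have c0 : 0 < c^2 - 1 by nra.
have [sb sc] := (sqrt_lt_R0 _ b0, sqrt_lt_R0 _ c0).
have [bb cc] : sqrt (b^2 - 1) ^ 2 = b^2 - 1 /\ sqrt (c^2 - 1) ^ 2 = c^2 - 1.
  by split; rewrite -Rsqr_pow2 Rsqr_sqrt; lra.
have E : z * z - 1 = gram a b c / ((b^2 - 1) * (c^2 - 1)).
  have -> : gram a b c = (a + b * c)^2 - (b^2 - 1) * (c^2 - 1) by rewrite /gram; ring.
  rewrite /z; move: sb sc bb cc; set p := sqrt (b^2 - 1); set q := sqrt (c^2 - 1).
  by move=> p0 q0 <- <-; field; lra.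
split=> //.
have z0 : 0 < z by apply: Rdiv_lt_0_compat; nra.
have : 0 < z * z - 1.
  by rewrite E; apply: Rdiv_lt_0_compat; [have := gram_gt1; lra|nra].
by nra.
Qed.

Lemma arc_acosh : acosh z = arc a b c.
Proof.
have b0 : 0 < b^2 - 1 by nra.
have c0 : 0 < c^2 - 1 by nra.
have [sb sc] := (sqrt_lt_R0 _ b0, sqrt_lt_R0 _ c0).
have [z1 zz] := hexagon_cosh_spec.
have g0 := gram_gt1; have sg := sqrt_pos (gram a b c).
rewrite /acosh zz sqrt_div_alt; last by nra.
rewrite sqrt_mult; try lra.
rewrite /z -Rdiv_plus_distr ln_div; try nra.
by rewrite ln_mult // !ln_sqrt // /arc; ring.
Qed.

Lemma arc_pos : 0 < arc a b c.
Proof. by rewrite -arc_acosh; apply: acosh_pos; case: hexagon_cosh_spec. Qed.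

Lemma sinh_arc : (sinh (arc a b c))^2 * ((b^2 - 1) * (c^2 - 1)) = gram a b c.
Proof.
have [z1 zz] := hexagon_cosh_spec.
rewrite -arc_acosh; have [|_ _ ->] := acosh_spec z; first lra.
rewrite -Rsqr_pow2 Rsqr_sqrt; last by nra.
have b0 : 0 < b^2 - 1 by nra.
have c0 : 0 < c^2 - 1 by nra.
by rewrite zz; field; lra.
Qed.

Lemma arc_form_neg v1 v2 v3 :
  v1 * darc a b c v1 v2 v3 + v2 * darc b c a v2 v3 v1 + v3 * darc c a b v3 v1 v2
  <= - 4 * / sqrt (gram a b c)
     * ((a - 1) * v1^2 + (b - 1) * v2^2 + (c - 1) * v3^2).
Proof.
rewrite /darc (_ : gram b c a = gram a b c); last by rewrite /gram; ring.
rewrite (_ : gram c a b = gram a b c); last by rewrite /gram; ring.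
have g0 : 0 < / sqrt (gram a b c).
  by apply/Rinv_0_lt_compat/sqrt_lt_R0; have := gram_gt1; lra.
set g := / sqrt _ in g0 *.
have p1 : 0 <= (b + c) / (a - 1) by apply: Rdiv_le_0_compat; lra.
have p2 : 0 <= (a + c) / (b - 1) by apply: Rdiv_le_0_compat; lra.
have p3 : 0 <= (a + b) / (c - 1) by apply: Rdiv_le_0_compat; lra.
(* The exact difference between the two sides. The diagonal terms kept in the bound already give
   definiteness, so [S] is only required to be nonnegative. *)
pose S := 2 * g * ((v1 - v2)^2 + (v2 - v3)^2 + (v3 - v1)^2
  + (b + c) / (a - 1) * (v2 + v3)^2 + (a + c) / (b - 1) * (v1 + v3)^2
  + (a + b) / (c - 1) * (v1 + v2)^2).
have S0 : 0 <= S.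
  apply: Rmult_le_pos; first lra.
  by repeat apply: Rplus_le_le_0_compat; try exact: pow2_ge_0;
    apply: Rmult_le_pos => //; exact: pow2_ge_0.
apply: Rminus_le; apply: (Rle_trans _ (- S)); last by lra.
by right; rewrite /S; field; lra.
Qed.

End Hexagon.

Lemma arc_derive (a b c : R -> R) t v1 v2 v3 :
  1 < a t -> 1 < b t -> 1 < c t ->
  is_derive a t (2 * (a t + 1) * (v2 + v3)) ->
  is_derive b t (2 * (b t + 1) * (v3 + v1)) ->
  is_derive c t (2 * (c t + 1) * (v1 + v2)) ->
  is_derive (fun s => arc (a s) (b s) (c s)) t (darc (a t) (b t) (c t) v1 v2 v3).
Proof.
move=> a1 b1 c1 da db dc.
have g1 := gram_gt1 _ _ _ a1 b1 c1.
have b0 : 0 < b t ^ 2 - 1 by nra.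
have c0 : 0 < c t ^ 2 - 1 by nra.
have sg0 : 0 < sqrt (gram (a t) (b t) (c t)) by apply: sqrt_lt_R0; lra.
have sgE : sqrt (gram (a t) (b t) (c t)) ^ 2 = gram (a t) (b t) (c t).
  by rewrite -Rsqr_pow2 Rsqr_sqrt; lra.
have [ea eb ec] : [/\ ex_derive (fun s => a s) t, ex_derive (fun s => b s) t
    & ex_derive (fun s => c s) t].
  by split; eexists; [exact: da|exact: db|exact: dc].
rewrite /arc /gram; auto_derive.
  move: g1 sg0 b0 c0; rewrite /gram /= => g1 sg0 b0 c0.
  by repeat split => //; first [lra|nra|
    apply: Rplus_lt_le_0_compat; [nra|exact: sqrt_pos]].
have -> : Derive (fun s => a s) t = 2 * (a t + 1) * (v2 + v3) by exact: is_derive_unique.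
have -> : Derive (fun s => b s) t = 2 * (b t + 1) * (v3 + v1) by exact: is_derive_unique.
have -> : Derive (fun s => c s) t = 2 * (c t + 1) * (v1 + v2) by exact: is_derive_unique.
rewrite (_ : a t * (a t * 1) + _ + _ + _ + _ = gram (a t) (b t) (c t)); last first.
  by rewrite /gram; ring.
rewrite /darc; move: sg0 sgE; set s := sqrt _ => s0 sE.
move: (a t) (b t) (c t) a1 b1 c1 sE b0 c0 => x y z x1 y1 z1 sE y0 z0.
have N0 : 0 < x + y * z + s by nra.
apply: Rminus_diag_uniq.
(* With the root [s] treated as a free variable, the two forms of the derivative differ by a
   multiple of gram - s^2, which vanishes for the actual root. *)
transitivity ((gram x y z - s ^ 2) / (s * (x + y * z + s)) *
  (y * (2 * (y + 1) * (v3 + v1)) / (y ^ 2 - 1) +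
   z * (2 * (z + 1) * (v1 + v2)) / (z ^ 2 - 1))); last by rewrite sE /Rdiv; ring.
by rewrite /gram; field; repeat split; nra.
Qed.

(** * Boundary lengths of a triangulated surface *)

Lemma Rsum_le_const (I : finType) (P : pred I) (F : I -> R) c :
  0 <= c -> (forall i, P i -> F i <= c) ->
  \big[Rplus/0]_(i | P i) F i <= INR #|I| * c.
Proof.
move=> c0 Fc; apply: (Rle_trans _ (\big[Rplus/0]_(i : I) c)).
  rewrite big_mkcond; apply: (big_ind2 Rle) => [|x y z t xy zt|i _].
  - exact: Rle_refl.
  - exact: Rplus_le_compat.
  - by case: ifP => // /Fc.
rewrite big_const; elim: #|I| => [|m IH] /=; first by lra.
by rewrite -/(INR m.+1) S_INR; lra.
Qed.

(** Every term of [gram] is of order b^2 c^2 / y, so sinh^2 of the arc, bounded below by [r], keeps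
    [y] bounded. Here [y] stands for the fourth power of the exponential of the factor at the
    arc. *)
Lemma arc_cosh_bound a b c y k h r :
  1 < a -> 1 < b -> 1 < c -> 0 < k -> 0 <= h -> 0 < r ->
  k * y <= b^2 -> k * y <= c^2 -> a * y <= h * (b * c) ->
  r * ((b^2 - 1) * (c^2 - 1)) <= gram a b c ->
  y <= 1 + 2 / k + 4 * (h^2 + 2 * h + 2 / k) / r.
Proof.
move=> a1 b1 c1 k0 h0 r0 yb yc ya gr.
have k2 : 0 < 2 / k by apply: Rdiv_lt_0_compat; lra.
have L0 : 0 <= h^2 + 2 * h + 2 / k by nra.
have Lr : 0 <= 4 * (h^2 + 2 * h + 2 / k) / r by apply: Rdiv_le_0_compat; lra.
(* Beyond this threshold b^2 and c^2 are at least 2, so b^2 c^2 <= 4 (b^2 - 1) (c^2 - 1), which is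
   the source of the factor 4; also y > 1, used to bound y a^2 by (a y)^2. *)
case: (Rle_lt_dec y (1 + 2 / k)) => [|ybig]; first by lra.
suff : y <= 4 * (h^2 + 2 * h + 2 / k) / r by lra.
have ky : 2 <= k * y.
  have : k * (2 / k) <= k * y by apply: Rmult_le_compat_l; lra.
  by rewrite (_ : k * (2 / k) = 2); [|field; lra].
set B := b^2 in yb gr *; set C := c^2 in yc gr *.
have BC4 : B * C <= 4 * ((B - 1) * (C - 1)) by nra.
have BC0 : 0 < B * C by nra.
have gB : gram a b c <= a^2 + B + C + 2 * a * (b * c) by rewrite /gram -/B -/C; lra.
have bc0 : 0 < b * c by nra.
have BCE : B * C = (b * c)^2 by rewrite /B /C; ring.
have t1 : y * a^2 <= h^2 * (B * C).
  have : (a * y)^2 <= (h * (b * c))^2 by apply: pow_incr; nra.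
  rewrite BCE !Rpow_mult_distr.
  have : y * a^2 <= a^2 * y^2 by nra.
  by lra.
have t2 : y * B <= / k * (B * C).
  have -> : y * B = / k * (B * (k * y)) by field; lra.
  apply: Rmult_le_compat_l; first exact/Rlt_le/Rinv_0_lt_compat.
  by apply: Rmult_le_compat_l => //; rewrite /B; nra.
have t3 : y * C <= / k * (B * C).
  have -> : y * C = / k * (k * y * C) by field; lra.
  apply: Rmult_le_compat_l; first exact/Rlt_le/Rinv_0_lt_compat.
  by apply: Rmult_le_compat_r => //; rewrite /C; nra.
have t4 : y * (2 * a * (b * c)) <= 2 * h * (B * C) by rewrite BCE; nra.
have tot : y * gram a b c <= (h^2 + 2 * h + 2 / k) * (B * C).
  have : y * gram a b c <= y * (a^2 + B + C + 2 * a * (b * c)).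
    by apply: Rmult_le_compat_l => //; lra.
  by rewrite /Rdiv; lra.
have : r * y <= 4 * (h^2 + 2 * h + 2 / k).
  apply: (Rmult_le_reg_r (B * C)) => //.
  have : y * (r * (B * C)) <= y * (4 * gram a b c).
    apply: Rmult_le_compat_l; first lra.
    by nra.
  by lra.
move=> ry; apply: (Rmult_le_reg_l r) => //.
by rewrite (_ : r * (_ / r) = 4 * (h^2 + 2 * h + 2 / k)) //; field; lra.
Qed.

(** A bounded arc gives a^2 <= M b^2 c^2. The powers of [E2] and [E3] agree on both sides and
    cancel, leaving a bound on [E1] alone. The constant 16 H^8 is the product of the two factors 4
    H^4 in the bounds of b^2 and c^2. *)
Lemma arc_cosh_lower a b c E1 E2 E3 h1 h2 h3 H M :
  1 < a -> 1 < b -> 1 < c -> 0 < E1 -> 0 < E2 -> 0 < E3 ->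
  1 <= h1 -> 0 <= h2 <= H -> 0 <= h3 <= H ->
  (E2 * E3 * h1)^2 <= a -> b <= 2 * (E3 * E1 * h2)^2 ->
  c <= 2 * (E1 * E2 * h3)^2 ->
  gram a b c <= M * ((b^2 - 1) * (c^2 - 1)) ->
  1 <= 16 * M * H^8 * E1^8.
Proof.
move=> a1 b1 c1 E10 E20 E30 h11 h2H h3H aL bU cU gM.
have ab : 0 < a * b by nra.
have b0 : 0 < b ^ 2 - 1 by nra.
have c0 : 0 < c ^ 2 - 1 by nra.
have bc0 : 0 < (b ^ 2 - 1) * (c ^ 2 - 1) by nra.
have ag : a^2 <= gram a b c.
  have abc : 0 < a * b * c by nra.
  by rewrite /gram; nra.
have M0 : 0 < M.
  have a20 : 0 < a ^ 2 by apply: pow_lt; lra.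
  apply: (Rmult_lt_reg_r ((b ^ 2 - 1) * (c ^ 2 - 1))) => //; lra.
have P0 : 0 < (E2 * E3)^4 by apply: pow_lt; nra.
apply: (Rmult_le_reg_r ((E2 * E3)^4)) => //.
have aL' : (E2 * E3)^4 <= a^2.
  have -> : (E2 * E3)^4 = ((E2 * E3)^2)^2 by ring.
  apply: pow_incr; split; first exact: pow2_ge_0.
  have EE : 0 < E2 * E3 by nra.
  by apply: Rle_trans aL; apply: pow_incr; nra.
have bU' : b^2 <= (2 * (E3 * E1 * H)^2)^2.
  apply: pow_incr; split; first lra.
  apply: (Rle_trans _ _ _ bU); apply: Rmult_le_compat_l; first lra.
  have EE : 0 < E3 * E1 by nra.
  by apply: pow_incr; nra.
have cU' : c^2 <= (2 * (E1 * E2 * H)^2)^2.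
  apply: pow_incr; split; first lra.
  apply: (Rle_trans _ _ _ cU); apply: Rmult_le_compat_l; first lra.
  have EE : 0 < E1 * E2 by nra.
  by apply: pow_incr; nra.
have : (b^2 - 1) * (c^2 - 1) <= (2 * (E3 * E1 * H)^2)^2 * (2 * (E1 * E2 * H)^2)^2.
  by apply: Rmult_le_compat; lra.
move=> /(Rmult_le_compat_l M _ _ (Rlt_le _ _ M0)) bcM.
apply: (Rle_trans _ (a ^ 2)); first lra.
apply: (Rle_trans _ _ _ ag); apply: (Rle_trans _ _ _ gM); apply: (Rle_trans _ _ _ bcM).
by right; ring.
Qed.

(** An instance of [arc_cosh_bound] with y = E1^4, k = A^4 and h = 2 H^2. The common lower bound [A]
    makes b and c grow with [E1], so lower bounds on the conformal factors must come first. *)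
Lemma arc_cosh_upper a b c E1 E2 E3 h1 h2 h3 H A r :
  1 < a -> 1 < b -> 1 < c -> 0 < E1 -> 0 < E2 -> 0 < E3 ->
  0 < A -> A <= E1 -> A <= E2 -> A <= E3 ->
  0 <= h1 <= H -> 1 <= h2 -> 1 <= h3 ->
  a <= 2 * (E2 * E3 * h1)^2 -> (E3 * E1 * h2)^2 <= b ->
  (E1 * E2 * h3)^2 <= c -> 0 < r ->
  r * ((b^2 - 1) * (c^2 - 1)) <= gram a b c ->
  E1^4 <= 1 + 2 / A^4 + 4 * ((2 * H^2)^2 + 2 * (2 * H^2) + 2 / A^4) / r.
Proof.
move=> a1 b1 c1 E10 E20 E30 A0 AE1 AE2 AE3 h1H h21 h31 aU bL cL r0 gr.
have EE2 : 0 < E3 * E1 by nra.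
have EE3 : 0 < E1 * E2 by nra.
have bL' : (E3 * E1)^2 <= b by apply: Rle_trans bL; apply: pow_incr; nra.
have cL' : (E1 * E2)^2 <= c by apply: Rle_trans cL; apply: pow_incr; nra.
have lower x E : 0 < E -> A <= E -> (E * E1)^2 <= x -> A^4 * E1^4 <= x^2.
  move=> E0 AE xL; apply: (Rle_trans _ (((E * E1)^2)^2)).
    have -> : ((E * E1)^2)^2 = E^4 * E1^4 by ring.
    apply: Rmult_le_compat_r; first by apply: pow_le; lra.
    by apply: pow_incr; lra.
  by apply: pow_incr; split=> //; apply: pow2_ge_0.
apply: (arc_cosh_bound a b c) => //.
- exact: pow_lt.
- by have := pow2_ge_0 H; lra.
- exact: (lower b E3).
- by apply: (lower c E2) => //; rewrite (Rmult_comm E2).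
apply: (Rle_trans _ (2 * H^2 * ((E3 * E1)^2 * (E1 * E2)^2))).
  apply: (Rle_trans _ (2 * (E2 * E3 * H)^2 * E1^4)); last by right; ring.
  apply: Rmult_le_compat_r; first by apply: pow_le; lra.
  apply: (Rle_trans _ _ _ aU); apply: Rmult_le_compat_l; first lra.
  have EE : 0 < E2 * E3 by nra.
  by apply: pow_incr; nra.
apply: Rmult_le_compat_l; first by have := pow2_ge_0 H; lra.
by apply: Rmult_le_compat => //; apply: pow2_ge_0.
Qed.

Lemma sinh_sq_le x y : 0 <= x <= y -> (sinh x)^2 <= (sinh y)^2.
Proof.
move=> [x0 [xy|->]]; last by lra.
by apply: pow_incr; split; [exact: sinh_ge0|apply: Rlt_le; apply: sinh_lt].
Qed.

(** * Edges and arcs of the deformed surface *)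

Section Surface.
Variables (n : nat) (T : tri_data n) (l0 : side T -> R).
Hypothesis T_valid : valid_triangulation T.
Hypothesis l0_metric : hyp_metric l0.

(** The hyperbolic cosine of half the new edge length. As a formula it makes sense for every [w], so
    it is continuous also at limit points not yet known to be admissible. *)
Definition half_cosh (w : vec n) (s : side T) : R :=
  exp (w (vlabel (endA s)) + w (vlabel (endB s))) * cosh (l0 s / 2).

Definition edge_cosh (w : vec n) (s : side T) : R := 2 * (half_cosh w s)^2 - 1.

Lemma endA3 (s : side T) : [/\ endA (endA s) = endB s, endB (endA s) = s,
  endA (endB s) = s & endB (endB s) = endA s].
Proof.
case: s => f c; have ord3 : ordS (ordS (ordS c)) = c.
  by apply: val_inj; case: c => [[|[|[|?]]] ?].
by split; rewrite /endA /endB //= ord3.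
Qed.

Lemma sum_endA (F : side T -> R) :
  \big[Rplus/0]_p F (endA p) = \big[Rplus/0]_p F p.
Proof.
rewrite [RHS](reindex (@endA n T)) //; apply: onW_bij.
by exists (@endB n T) => s; case: (endA3 s).
Qed.

Lemma label_corner i : exists p : side T, vlabel p = i.
Proof. by case: T_valid => _ _ _ _ [_]; apply. Qed.

Lemma half_cosh_gt1 w : admissible l0 w <-> forall s, 1 < half_cosh w s.
Proof.
have E t : half_cosh w t = exp (w (vlabel (endA t)) + w (vlabel (endB t)) + ln (cosh (l0 t / 2))).
  by rewrite exp_plus exp_ln // ; have := cosh_ge1 (l0 t / 2); lra.
split=> wW t; have := wW t; rewrite E -{1}exp_0.
  by move=> ?; apply: exp_increasing; lra.
by move/exp_lt_inv; lra.
Qed.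

Lemma edge_cosh_gt1 w s : admissible l0 w -> 1 < edge_cosh w s.
Proof. by move/(half_cosh_gt1 w)/(_ s); rewrite /edge_cosh; nra. Qed.

Lemma conf_len_cosh w s : admissible l0 w ->
  cosh (conf_len l0 w s) = edge_cosh w s /\
  sinh (conf_len l0 w s) = sqrt ((edge_cosh w s)^2 - 1).
Proof.
move=> /(half_cosh_gt1 w)/(_ s) h1.
have [|a0 ca _] := acosh_spec (half_cosh w s); first lra.
have E : cosh (conf_len l0 w s) = edge_cosh w s.
  by rewrite /conf_len cosh_double -/(half_cosh w s) ca.
split=> //; rewrite -E; apply: sinh_sqrt.
by rewrite /conf_len -/(half_cosh w s); lra.
Qed.

Definition corner_arc (w : vec n) (p : side T) : R :=
  arc (edge_cosh w p) (edge_cosh w (endA p)) (edge_cosh w (endB p)).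

Lemma theta_arc w p : admissible l0 w -> theta (conf_len l0 w) p = corner_arc w p.
Proof.
move=> wW; rewrite /theta /corner_arc.
have [-> _] := conf_len_cosh w p wW.
have [-> ->] := conf_len_cosh w (endA p) wW.
have [-> ->] := conf_len_cosh w (endB p) wW.
by apply: arc_acosh; apply: edge_cosh_gt1.
Qed.

Lemma psi_arc w i : admissible l0 w ->
  psi l0 w i = \big[Rplus/0]_(p | vlabel p == i) corner_arc w p.
Proof. by move=> wW; apply: eq_bigr => p _; apply: theta_arc. Qed.

Lemma corner_arc_pos w p : admissible l0 w -> 0 < corner_arc w p.
Proof. by move=> wW; apply: arc_pos; apply: edge_cosh_gt1. Qed.

Lemma corner_arc_le_psi w p : admissible l0 w ->
  corner_arc w p <= psi l0 w (vlabel p).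
Proof.
move=> wW; rewrite psi_arc //.
apply: (Rsum_ge_term _ (fun q => vlabel q == vlabel p)) => // q _.
exact/Rlt_le/corner_arc_pos.
Qed.

Lemma psi_pos w i : admissible l0 w -> 0 < psi l0 w i.
Proof.
move=> wW; have [p <-] := label_corner i.
by apply: Rlt_le_trans (corner_arc_le_psi w p wW); apply: corner_arc_pos.
Qed.

Lemma half_cosh_Ck k U s : Defs.open_set U -> Ck k U (fun w => half_cosh w s).
Proof.
move=> oU; apply: Ck_mul => //; last exact: Ck_const.
by apply: Ck_exp => //; apply: Ck_add => //; apply: Ck_coord.
Qed.

Lemma edge_cosh_Ck k U s : Defs.open_set U -> Ck k U (fun w => edge_cosh w s).
Proof.
move=> oU; have hk := half_cosh_Ck k U s oU.
apply: (Ck_ext _ _ _ (fun w => 2 * (half_cosh w s * half_cosh w s) + - 1)) => //.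
  by move=> w _; rewrite /edge_cosh; ring.
apply: Ck_add => //; last exact: Ck_const.
by apply: Ck_mul => //; [exact: Ck_const|exact: Ck_mul].
Qed.

Lemma open_univ : Defs.open_set (fun _ : vec n => True).
Proof. by move=> x _; exists 1; split=> //; lra. Qed.

Lemma half_cosh_lim w s :
  filterlim (fun x => half_cosh x s) (vnbhs n w) (locally (half_cosh w s)).
Proof. by apply/cont_atE; apply: (Ck_cont _ _ _ _ _ (half_cosh_Ck 0 _ s open_univ)). Qed.

Lemma edge_cosh_lim w s :
  filterlim (fun x => edge_cosh x s) (vnbhs n w) (locally (edge_cosh w s)).
Proof. by apply/cont_atE; apply: (Ck_cont _ _ _ _ _ (edge_cosh_Ck 0 _ s open_univ)). Qed.

Lemma admissible_open : Defs.open_set (admissible l0).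
Proof.
move=> w /half_cosh_gt1 wW.
apply: (filter_imp (F := vnbhs n w) (fun x => forall s : side T, 1 < half_cosh x s)).
  by move=> x /half_cosh_gt1.
apply: filter_forall_fin => s.
apply: (half_cosh_lim w s); exact: open_gt.
Qed.

Lemma admissible0 : admissible l0 (fun=> 0).
Proof.
move=> s; have [l_pos _] := l0_metric s.
suff : 0 < ln (cosh (l0 s / 2)) by lra.
rewrite -ln_1; apply: ln_increasing; first lra.
by apply: cosh_gt1; lra.
Qed.

Lemma admissible_convex x y t : admissible l0 x -> admissible l0 y ->
  0 <= t <= 1 -> admissible l0 (fun i => x i + t * (y i - x i)).
Proof.
move=> xW yW t01 s; have := xW s; have := yW s.
set L := ln _; set a := x _; set b := x _; set c := y _; set d := y _ => cd ab.
by case: (Req_dec t 0) => [->|]; nra.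
Qed.

Lemma psi_smooth : smooth_map (admissible l0) (psi l0).
Proof.
have oW := admissible_open.
move=> i k; apply: (Ck_ext _ _ _ (fun w => \big[Rplus/0]_(p | vlabel p == i) corner_arc w p)) => //.
  by move=> w wW; rewrite psi_arc.
apply: Ck_sum => // p.
have eC s := edge_cosh_Ck k _ s oW.
have cC c : Ck k (admissible l0) (fun _ => c) by apply: Ck_const.
have sqC s : Ck k (admissible l0) (fun w => ln (edge_cosh w s ^ 2 - 1)).
  apply: (Ck_ext _ _ _ (fun w => ln (edge_cosh w s * edge_cosh w s + - 1))) => //.
    by move=> w _; congr ln; ring.
  apply: Ck_ln => //; first by move=> w wW; have := edge_cosh_gt1 w s wW; nra.
  by apply: Ck_add => //; apply: Ck_mul.
pose C1 w := edge_cosh w p; pose C2 w := edge_cosh w (endA p).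
pose C3 w := edge_cosh w (endB p).
have gC : Ck k (admissible l0) (fun w => gram (C1 w) (C2 w) (C3 w)).
  apply: (Ck_ext _ _ _ (fun w => C1 w * C1 w + C2 w * C2 w + C3 w * C3 w +
      2 * C1 w * C2 w * C3 w + - 1)) => //.
    by move=> w _; rewrite /gram; ring.
  by repeat first [exact: oW|exact: eC|exact: cC|apply: Ck_add|apply: Ck_mul].
have g1 w : admissible l0 w -> 1 < gram (C1 w) (C2 w) (C3 w).
  by move=> wW; apply: gram_gt1; apply: edge_cosh_gt1.
apply: (Ck_ext _ _ _ (fun w => ln (C1 w + C2 w * C3 w + sqrt (gram (C1 w) (C2 w) (C3 w)))
   + (- / 2) * ln (C2 w ^ 2 - 1) + (- / 2) * ln (C3 w ^ 2 - 1))) => //.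
  by move=> w _; rewrite /corner_arc /arc -/(C1 w) -/(C2 w) -/(C3 w); ring.
apply: Ck_add => //; last by apply: Ck_mul => //; exact: sqC.
apply: Ck_add => //; last by apply: Ck_mul => //; exact: sqC.
apply: Ck_ln => // [w wW|].
  have := sqrt_pos (gram (C1 w) (C2 w) (C3 w)).
  have := edge_cosh_gt1 w p wW; have := edge_cosh_gt1 w (endA p) wW.
  have := edge_cosh_gt1 w (endB p) wW; rewrite -/(C1 w) -/(C2 w) -/(C3 w); nra.
apply: Ck_add => //; first by apply: Ck_add; [|exact: eC|apply: Ck_mul; [|exact: eC|exact: eC]].
by apply: Ck_sqrt => // w wW; have := g1 w wW; lra.
Qed.

(** * The Jacobian of the boundary-length map *)

Lemma edge_cosh_derive (w v : vec n) s t :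
  is_derive (fun r => edge_cosh (fun i => w i + r * v i) s) t
    (2 * (edge_cosh (fun i => w i + t * v i) s + 1)
       * (v (vlabel (endA s)) + v (vlabel (endB s)))).
Proof. by rewrite /edge_cosh /half_cosh; auto_derive => //; ring. Qed.

Definition corner_darc (w v : vec n) (p : side T) : R :=
  darc (edge_cosh w p) (edge_cosh w (endA p)) (edge_cosh w (endB p))
    (v (vlabel p)) (v (vlabel (endA p))) (v (vlabel (endB p))).

(** Both sides are the derivative of [psi] along the line through [w] with direction [v], by the
    chain rule and by differentiating each arc; the individual entries of the Jacobian are never
    computed. *)
Lemma psi_gradient w v i : admissible l0 w ->
  \big[Rplus/0]_j (pderiv (fun x => psi l0 x i) j w * v j) =
  \big[Rplus/0]_(p | vlabel p == i) corner_darc w v p.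
Proof.
move=> wW; pose c r : vec n := fun i => w i + r * v i.
have c0 : c 0 = w by apply: functional_extensionality => j; rewrite /c; ring.
have cd j : is_derive (fun r => c r j) 0 (v j).
  by rewrite /c; auto_derive => //; ring.
have := chain_rule n (admissible l0) (fun x => psi l0 x i) c 0 v admissible_open.
rewrite c0 => /(_ wW (psi_smooth i 1%N) cd) /is_derive_unique <-.
apply: is_derive_unique.
apply: (is_derive_ext_loc (fun r => \big[Rplus/0]_(p | vlabel p == i) corner_arc (c r) p)).
  have cl : filterlim c (locally 0) (vnbhs n w).
    apply: filterlim_vec => j; rewrite -c0.
    by apply: (ex_derive_continuous (fun r => c r j)); exists (v j).
  have near : locally 0 (fun r => admissible l0 (c r)) := cl _ (admissible_open w wW).
  apply: filter_imp near => r rW.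
  by rewrite psi_arc.
apply: (is_derive_ext (fun r =>
  \big[Rplus/0]_(p <- [seq p <- index_enum _ | vlabel p == i]) corner_arc (c r) p)).
  by move=> r; rewrite big_filter.
rewrite -big_filter; apply: is_derive_Rsum => p.
have ed s : is_derive (fun r => edge_cosh (c r) s) 0
    (2 * (edge_cosh (c 0) s + 1) * (v (vlabel (endA s)) + v (vlabel (endB s)))).
  exact: edge_cosh_derive.
rewrite /corner_darc -c0.
have [eAA eBA eAB eBB] := endA3 p.
apply: arc_derive; try (by rewrite c0; apply: edge_cosh_gt1).
- exact: ed.
- by have := ed (endA p); rewrite eAA eBA.
- by have := ed (endB p); rewrite eAB eBB.
Qed.

Lemma psi_form_neg w v : admissible l0 w -> (exists i, v i <> 0) ->
  \big[Rplus/0]_i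
    (v i * \big[Rplus/0]_j (pderiv (fun x => psi l0 x i) j w * v j)) < 0.
Proof.
move=> wW [i vi].
pose F p := v (vlabel p) * corner_darc w v p.
have -> : \big[Rplus/0]_i
    (v i * \big[Rplus/0]_j (pderiv (fun x => psi l0 x i) j w * v j)) =
    \big[Rplus/0]_p F p.
  rewrite [RHS](partition_big (@vlabel n T) predT) //=.
  apply: eq_bigr => j _; rewrite psi_gradient // Rsum_scal.
  by apply: eq_bigr => p /eqP <-.
pose H p := - (F p + F (endA p) + F (endB p)).
(* The hexagon form is summed over corners instead of faces: rotation by [endA] permutes the
   corners, so each face is counted three times. *)
have HE : 3 * \big[Rplus/0]_p F p = - \big[Rplus/0]_p H p.
  have -> : \big[Rplus/0]_p H p =
      -1 * \big[Rplus/0]_p (F p + F (endA p) + F (endB p)).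
    by rewrite Rsum_scal; apply: eq_bigr => p _; rewrite /H; ring.
  rewrite !big_split /= (sum_endA F).
  have -> : \big[Rplus/0]_p F (endB p) = \big[Rplus/0]_p F p.
    rewrite -[LHS](sum_endA (fun p => F (endB p))).
    by apply: eq_bigr => p _; case: (endA3 p) => _ -> .
  by set X := bigop _ _ _; ring.
have Hlow p : 4 * / sqrt (gram (edge_cosh w p) (edge_cosh w (endA p)) (edge_cosh w (endB p)))
    * ((edge_cosh w p - 1) * v (vlabel p) ^ 2) <= H p.
  have a1 := edge_cosh_gt1 w p wW; have b1 := edge_cosh_gt1 w (endA p) wW.
  have c1 := edge_cosh_gt1 w (endB p) wW.
  have := arc_form_neg _ _ _ a1 b1 c1 (v (vlabel p)) (v (vlabel (endA p))) (v (vlabel (endB p))).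
  have [eAA eBA eAB eBB] := endA3 p.
  rewrite /H /F /corner_darc eAA eBA eAB eBB.
  have g0 : 0 < / sqrt (gram (edge_cosh w p) (edge_cosh w (endA p)) (edge_cosh w (endB p))).
    by apply/Rinv_0_lt_compat/sqrt_lt_R0; have := gram_gt1 _ _ _ a1 b1 c1; lra.
  have : 0 <= (edge_cosh w (endA p) - 1) * v (vlabel (endA p)) ^ 2.
    by apply: Rmult_le_pos; [lra|exact: pow2_ge_0].
  have : 0 <= (edge_cosh w (endB p) - 1) * v (vlabel (endB p)) ^ 2.
    by apply: Rmult_le_pos; [lra|exact: pow2_ge_0].
  by nra.
have low0 p : 0 <= 4 * / sqrt (gram (edge_cosh w p) (edge_cosh w (endA p)) (edge_cosh w (endB p)))
    * ((edge_cosh w p - 1) * v (vlabel p) ^ 2) /\ (v (vlabel p) <> 0 -> 0 < H p).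
  have a1 := edge_cosh_gt1 w p wW; have b1 := edge_cosh_gt1 w (endA p) wW.
  have c1 := edge_cosh_gt1 w (endB p) wW.
  have g0 : 0 < / sqrt (gram (edge_cosh w p) (edge_cosh w (endA p)) (edge_cosh w (endB p))).
    by apply/Rinv_0_lt_compat/sqrt_lt_R0; have := gram_gt1 _ _ _ a1 b1 c1; lra.
  split.
    apply: Rmult_le_pos; first lra.
    by apply: Rmult_le_pos; [lra|exact: pow2_ge_0].
  move=> v0; apply: Rlt_le_trans (Hlow p).
  apply: Rmult_lt_0_compat; first lra.
  by apply: Rmult_lt_0_compat; [lra|apply: pow2_gt_0].
have [p pi] := label_corner i.
have : H p <= \big[Rplus/0]_q H q.
  apply: (Rsum_ge_term _ predT H) => // q _.
  by have := Hlow q; have := proj1 (low0 q); lra.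
by have := proj2 (low0 p); rewrite pi => /(_ vi); lra.
Qed.


(** * Properness of the boundary-length map *)

Lemma sinh_corner_arc w p : admissible l0 w ->
  (sinh (corner_arc w p))^2 *
    ((edge_cosh w (endA p) ^ 2 - 1) * (edge_cosh w (endB p) ^ 2 - 1)) =
  gram (edge_cosh w p) (edge_cosh w (endA p)) (edge_cosh w (endB p)).
Proof. by move=> wW; apply: sinh_arc; apply: edge_cosh_gt1. Qed.

Lemma sinh_corner_arc_le w K p : admissible l0 w -> (forall i, psi l0 w i <= K) ->
  (sinh (corner_arc w p))^2 <= (sinh K)^2.
Proof.
move=> wW wK; apply: sinh_sq_le; split; first exact/Rlt_le/corner_arc_pos.
exact: Rle_trans (corner_arc_le_psi w p wW) (wK _).
Qed.

(** The arc at [endB s] lies between the edges [s] and [endA s]. In its identity with [gram], the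
    right side is at least c^2 - 1 for the edge [endA s]; cancelling this factor leaves a bound on
    [s] alone. *)
Lemma edge_cosh_lower w K s : admissible l0 w -> (forall i, psi l0 w i <= K) ->
  1 <= (sinh K)^2 * (edge_cosh w s ^ 2 - 1).
Proof.
move=> wW wK; have [_ _ eAB eBB] := endA3 s.
have := sinh_corner_arc w (endB s) wW; rewrite eAB eBB /gram.
have := sinh_corner_arc_le w K (endB s) wW wK.
have := edge_cosh_gt1 w s wW; have := edge_cosh_gt1 w (endA s) wW.
have := edge_cosh_gt1 w (endB s) wW.
move: (edge_cosh w s) (edge_cosh w (endA s)) (edge_cosh w (endB s)) => b c a.
move=> a1 c1 b1; set m := (sinh (_ _ _)) ^ 2; set M := (sinh K) ^ 2 => mM E.
have c0 : 0 < c ^ 2 - 1 by nra.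
have b0 : 0 < b ^ 2 - 1 by nra.
have : 1 * (c ^ 2 - 1) <= m * (b ^ 2 - 1) * (c ^ 2 - 1).
  have ac : 0 < a * c by nra.
  have acb : 0 < a * c * b by nra.
  by have := pow2_ge_0 a; have := pow2_ge_0 b; lra.
by move/Rmult_le_reg_r => /(_ c0) ?; nra.
Qed.

Lemma edge_cosh_bounds w s : admissible l0 w ->
  (half_cosh w s)^2 <= edge_cosh w s <= 2 * (half_cosh w s)^2.
Proof. by move/half_cosh_gt1/(_ s); rewrite /edge_cosh; nra. Qed.

Lemma half_cosh_bound : exists2 H, 1 <= H & forall s : side T, cosh (l0 s / 2) <= H.
Proof.
have : Rbar_locally p_infty (fun H => 1 <= H /\ forall s : side T, cosh (l0 s / 2) <= H).
  apply: filter_and; first by exists 1 => y; lra.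
  by apply: filter_forall_fin => s; exists (cosh (l0 s / 2)) => y; lra.
move=> [M MP]; have [|h1 h2] := MP (M + 1); first lra.
by exists (M + 1).
Qed.

Lemma conformal_lower K : exists A, forall w, admissible l0 w ->
  (forall i, psi l0 w i <= K) -> forall i, A <= w i.
Proof.
have [H H1 HP] := half_cosh_bound.
pose M := (sinh K)^2.
exists (- (ln (16 * M * H^8) / 8)) => w wW wK i.
have [p <-] := label_corner i.
have e0 j := exp_pos (w j).
have [eAA eBA eAB eBB] := endA3 p.
have [aL _] := edge_cosh_bounds w p wW.
have [_ bU] := edge_cosh_bounds w (endA p) wW.
have [_ cU] := edge_cosh_bounds w (endB p) wW.
have : 1 <= 16 * M * H^8 * exp (w (vlabel p)) ^ 8.
  move: aL bU cU; rewrite /half_cosh eAA eBA eAB eBB !exp_plus => aL bU cU.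
  apply: (arc_cosh_lower (edge_cosh w p) (edge_cosh w (endA p)) (edge_cosh w (endB p))
    _ _ _ (cosh (l0 p / 2)) (cosh (l0 (endA p) / 2)) (cosh (l0 (endB p) / 2)) _ _
    _ _ _ (e0 _) (e0 _) (e0 _) _ _ _ aL bU cU); try exact: edge_cosh_gt1.
  - exact: cosh_ge1.
  - by split; [have := cosh_ge1 (l0 (endA p) / 2); lra|exact: HP].
  - by split; [have := cosh_ge1 (l0 (endB p) / 2); lra|exact: HP].
  rewrite -(sinh_corner_arc w p wW); apply: Rmult_le_compat_r.
    have := edge_cosh_gt1 w (endA p) wW; have := edge_cosh_gt1 w (endB p) wW.
    by move=> ? ?; apply: Rmult_le_pos; nra.
  exact: sinh_corner_arc_le.
have X0 : 0 < exp (w (vlabel p)) ^ 8 by apply: pow_lt.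
(* The bound was chosen from [K] before any [w], when [M] could still be 0; positivity of the
   logarithm's argument follows from the inequality just obtained. *)
move=> le1; have M0 : 0 < 16 * M * H ^ 8.
  by apply: Rnot_le_lt => ?; nra.
have := ln_le 1 _ Rlt_0_1 le1.
rewrite ln_mult // ln_1 ln_pow // ln_exp /=; lra.
Qed.

Lemma conformal_upper e K : 0 < e -> exists A, forall w, admissible l0 w ->
  (forall i, e <= psi l0 w i <= K) -> forall i, w i <= A.
Proof.
move=> e0; have [A AP] := conformal_lower K.
have [H H1 HP] := half_cosh_bound.
pose N := INR #|{: face T * 'I_3}|.
have N0 : 0 <= N by apply: pos_INR.
have eN : 0 < e / (N + 1) by apply: Rdiv_lt_0_compat; lra.
pose r := (sinh (e / (N + 1)))^2.
have r0 : 0 < r by apply: pow_lt; rewrite -sinh_0; apply: sinh_lt.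
pose k := (exp A ^ 4); have k0 : 0 < k by apply/pow_lt/exp_pos.
pose h := 2 * H^2; have h0 : 0 <= h by rewrite /h; nra.
pose Y := 1 + 2 / k + 4 * (h^2 + 2 * h + 2 / k) / r.
exists (ln Y / 4) => w wW wb i.
(* Pigeonhole: if all arcs on the component were shorter, its length would be at most N e / (N + 1)
   < e. Dividing by N + 1 makes the inequality strict. *)
have [p [<- pe]] : exists p, vlabel p = i /\ e / (N + 1) <= corner_arc w p.
  apply: NNPP => none.
  have small p : vlabel p = i -> corner_arc w p <= e / (N + 1).
    by move=> pi; apply: Rnot_lt_le => ?; apply: none; exists p; split=> //; lra.
  have : psi l0 w i <= N * (e / (N + 1)).
    by rewrite psi_arc //; apply: Rsum_le_const => [|p /eqP]; [lra|exact: small].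
  have -> : N * (e / (N + 1)) = e - e / (N + 1) by field; lra.
  by have := wb i; lra.
have a1 := edge_cosh_gt1 w p wW; have b1 := edge_cosh_gt1 w (endA p) wW.
have c1 := edge_cosh_gt1 w (endB p) wW.
have x0 j := exp_pos (w j).
have wA j : exp A <= exp (w j).
  have [|Aw|->] := AP w wW _ j; [by move=> l; case: (wb l)| |exact: Rle_refl].
  exact/Rlt_le/exp_increasing.
have [eAA eBA eAB eBB] := endA3 p.
have YP : exp (w (vlabel p)) ^ 4 <= Y.
  have [_ aU] := edge_cosh_bounds w p wW.
  have [bL _] := edge_cosh_bounds w (endA p) wW.
  have [cL _] := edge_cosh_bounds w (endB p) wW.
  move: aU bL cL; rewrite /half_cosh eAA eBA eAB eBB !exp_plus => aU bL cL.
  apply: (arc_cosh_upper _ _ _ _ _ _ _ _ _ H (exp A) r a1 b1 c1 _ _ _ (exp_pos A)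
     (wA _) (wA _) (wA _) _ _ _ aU bL cL) => //.
  - by split; [have := cosh_ge1 (l0 p / 2); lra|exact: HP].
  - exact: cosh_ge1.
  - exact: cosh_ge1.
  rewrite -(sinh_corner_arc w p wW); apply: Rmult_le_compat_r.
    by apply: Rmult_le_pos; nra.
  by apply: sinh_sq_le; lra.
have := ln_le _ _ (pow_lt _ 4 (x0 (vlabel p))) YP.
by rewrite ln_pow // ln_exp /=; lra.
Qed.

(** The factors stay in a box, so a subsequence converges. Its limit could leave the admissible set
    only if some edge shrank to length 0, and the bound of [edge_cosh_lower], which survives the
    limit, excludes this. *)
Lemma psi_proper e K (u : nat -> vec n) : 0 < e ->
  (forall k, admissible l0 (u k)) -> (forall k i, e <= psi l0 (u k) i <= K) ->
  exists phi : nat -> nat, filterlim phi eventually eventually /\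
    exists2 l, admissible l0 l &
      filterlim (fun k => u (phi k)) eventually (vnbhs n l).
Proof.
move=> e0 uW ub.
have [A AP] := conformal_lower K; have [B BP] := conformal_upper e K e0.
have [|phi [phioo [l ul]]] := bounded_subseq_vec n u (Rmax (- A) B).
  move=> k i; have := BP _ (uW k) (ub k) i.
  have := AP _ (uW k) (fun i => proj2 (ub k i)) i.
  by have := Rmax_l (- A) B; have := Rmax_r (- A) B; split_Rabs; lra.
exists phi; split=> //; exists l => //; apply/half_cosh_gt1 => s.
have hl := filterlim_comp _ _ _ _ _ _ _ _ ul (half_cosh_lim l s).
have el := filterlim_comp _ _ _ _ _ _ _ _ ul (edge_cosh_lim l s).
have h1 : 1 <= half_cosh l s.
  apply: filterlim_le_const hl _ => k; apply: Rlt_le.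
  exact: (proj1 (half_cosh_gt1 _) (uW _)).
have e1 : 1 <= (sinh K)^2 * (edge_cosh l s * edge_cosh l s + - 1).
  apply: (filterlim_le_const (fun k => (sinh K)^2 *
      (edge_cosh (u (phi k)) s * edge_cosh (u (phi k)) s + - 1))).
    apply: filterlim_prod; first exact: filterlim_const.
    by apply: filterlim_add; [exact: filterlim_prod|exact: filterlim_const].
  move=> k; have := edge_cosh_lower _ K s (uW (phi k)) (fun i => proj2 (ub _ i)).
  by rewrite (_ : _ ^ 2 - 1 = edge_cosh (u (phi k)) s * edge_cosh (u (phi k)) s + - 1); last ring.
case: h1 => // h1; move: e1; rewrite /edge_cosh -h1.
by rewrite (_ : (2 * 1 ^ 2 - 1) * _ + - 1 = 0); [lra|ring].
Qed.

End Surface.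

Theorem theorem1p1 (n : nat) (T : tri_data n) (l0 : side T -> R) :
  valid_triangulation T -> hyp_metric l0 ->
  diffeo_onto (admissible l0) (fun B : vec n => forall i, (0 < B i)%R)
    (psi l0).
Proof.
move=> T_valid l0_metric.
apply: proper_monotone_diffeo.
- exact: admissible_open.
- by exists (fun=> 0); apply: admissible0.
- exact: admissible_convex.
- exact: psi_smooth.
- by move=> w wW i; apply: psi_pos.
- exact: psi_form_neg.
- exact: psi_proper.
Qed.
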